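(* Let $\{\xi_n,n<\infty\}$ be the controlled Markov chain on the finite state space $S$ with absorbing set $\partial S\subset S$, controlled by relaxed controls as described in the context. Assume that there are an integer $n\ge 1$ and a real number $\gamma>0$ such that, for every $x\in S$ and every admissible relaxed control policy, $$P(\xi_n\in\partial S\mid \xi_0=x,\ m_{1,k},m_{2,k},\ k\le n)\ \ge\ \gamma .$$ Assume that, for all $x,y\in S$, the functions $p(x,y|\cdot,\cdot)$ and $c(x,\cdot,\cdot)$ are continuous on $U_1\times U_2$. Let $V_m^+$ and $V_m^-$ be the upper and lower values over relaxed controls defined in the context. Then there always exists a saddle point, that is, $$V_m^+(x)=V_m^-(x)\quad\text{for all } x\in S .$$
   Context: Two-player zero-sum discrete Markov game with relaxed controls. $S$ is a finite set and $\partial S\subset S$ is a collection of absorbing states. $U_1,U_2$ are compact subsets of $\mathbb{R}$. For $(r_1,r_2)\in U_1\times U_2$, $p(x,y|r_1,r_2)$, $x,y\in S$, are transition probabilities on $S$; $c:S\times U_1\times U_2\to[0,\infty)$ is the running cost and $g:S\to[0,\infty)$ the terminal cost. $\mathcal{P}(U_i)$ denotes the set of probability measures on the Borel $\sigma$-algebra of $U_i$. A real function $f$ on $U_1\times U_2$ is extended to $\mathcal{P}(U_1)\times\mathcal{P}(U_2)$ by $$f(\mu_1,\mu_2)=\int_{U_1}\int_{U_2}f(r_1,r_2)\,\mu_1(dr_1)\,\mu_2(dr_2);$$ in particular this defines $p(x,y|\mu_1,\mu_2)$ and $c(x,\mu_1,\mu_2)$. A relaxed control policy is a sequence $\{(m_{1,n},m_{2,n}),n<\infty\}$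 with $m_{i,n}$ a (possibly random) element of $\mathcal{P}(U_i)$; it is admissible if $P\{\xi_{n+1}=y\mid\xi_k,m_{1,k},m_{2,k},k\le n\}=p(\xi_n,y|m_{1,n},m_{2,n})$. The cost under such a policy with $\xi_0=x$ is $$W(x,m_1,m_2)=E_x^{m_1,m_2}\Big[\sum_{n=0}^{N-1}c(\xi_n,m_{1,n},m_{2,n})+g(\xi_N)\Big],\qquad N=\min\{n:\xi_n\in\partial S\}.$$ $\Gamma_i(1)$ is the set of admissible relaxed controls of player $i$ when player $i$ goes first: there are measurable $\mathcal{P}(U_i)$-valued functions $H_n$ with $m_{i,n}=H_n(\xi_k,k\le n;\ m_{1,k},m_{2,k},k<n)$. $\Gamma_i(2)$ is the set of admissible relaxed controls of player $i$ when player $i$ goes last: there are measurable $\mathcal{P}(U_i)$-valued functions $\widetilde H_n$ with $m_{i,n}=\widetilde H_n(\xi_k,k\le n;\ m_{i,k},k<n;\ m_{j,k},k\le n,\ j\ne i)$. Upper and lower values: $$V_m^+(x)=\min_{m_1\in\Gamma_1(1)}\max_{m_2\in\Gamma_2(2)}W(x,m_1,m_2),\qquad V_m^-(x)=\max_{m_2\in\Gamma_2(1)}\min_{m_1\in\Gamma_1(2)}W(x,m_1,m_2).$$ *)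

(* Defs.v *)
(* MathComp-Analysis, over an arbitrary realType. *)
From HB Require Import structures.
From mathcomp Require Import all_boot all_order all_algebra.
From mathcomp Require Import all_classical all_reals all_analysis.
Set Implicit Arguments.
Unset Strict Implicit.
Unset Printing Implicit Defensive.
Import Order.TTheory GRing.Theory Num.Theory.
Import numFieldNormedType.Exports.
Local Open Scope classical_set_scope.
Local Open Scope ring_scope.

(* [p x y r1 r2] is p(x, y | r1, r2); only r1 \in U1, r2 \in U2 matter. *)
Record game (R : realType) (S : finType) := Game {
  absorbing : {set S} ;
  U1 : set R ;
  U2 : set R ;
  p : S -> S -> R -> R -> R ;
  c : S -> R -> R -> R ;
  g : S -> R }.

Definition is_game (R : realType) (S : finType) (G : game R S) : Prop :=
  [/\ compact (U1 G) /\ U1 G !=set0,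
      compact (U2 G) /\ U2 G !=set0,
      (forall r1 r2, U1 G r1 -> U2 G r2 ->
         (forall x y, 0 <= p G x y r1 r2) /\
         (forall x, \sum_y p G x y r1 r2 = 1)),
      (forall x r1 r2, x \in absorbing G -> U1 G r1 -> U2 G r2 ->
         p G x x r1 r2 = 1) &
      (forall x r1 r2, U1 G r1 -> U2 G r2 -> 0 <= c G x r1 r2) /\
      (forall x, 0 <= g G x)].

(* Borel probability measures on R, with the sigma-algebra generated by the
   evaluations mu |-> mu B.  P(U) is identified with those giving mass 1 to the
   compact set U. *)
Definition relaxed (R : realType) := pprobability (measurableTypeR R) R.

Definition PU (R : realType) (U : set R) : set (relaxed R) :=
  [set mu : relaxed R | (mu : probability (measurableTypeR R) R) U = 1%E].

Definition extend (R : realType) (S : finType) (G : game R S)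
    (f : R -> R -> R) (mu1 mu2 : relaxed R) : \bar R :=
  (\int[(mu1 : probability (measurableTypeR R) R)]_(r1 in U1 G)
     \int[(mu2 : probability (measurableTypeR R) R)]_(r2 in U2 G)
       (f r1 r2)%:E)%E.

(* A chain and its two control sequences on some probability space; the controls
   are arbitrary random measures, not necessarily functions of past data. *)
Record controlled_chain (R : realType) (S : finType) := ControlledChain {
  disp : measure_display ;
  Omega : measurableType disp ;
  Pr : probability Omega R ;
  xi : nat -> Omega -> S ;
  m1 : nat -> Omega -> relaxed R ;
  m2 : nat -> Omega -> relaxed R }.

Arguments xi {R S} c.
Arguments m1 {R S} c.
Arguments m2 {R S} c.

(* sigma(xi_k, m_{1,k}, m_{2,k}, k <= n) *)
Definition history (R : realType) (S : finType) (C : controlled_chain R S)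
    (n : nat) : set (set (Omega C)) :=
  <<s \bigcup_(k in [set k | (k <= n)%N])
        (range (fun y : S => xi C k @^-1` [set y]) `|`
         preimage_set_system setT (m1 C k) measurable `|`
         preimage_set_system setT (m2 C k) measurable) >>.

Arguments history {R S} C n.

(* The last clause is the defining property of the conditional probability
   P{xi_{n+1} = y | xi_k, m_{1,k}, m_{2,k}, k <= n}. *)
Definition admissible (R : realType) (S : finType) (G : game R S) (x : S)
    (C : controlled_chain R S) : Prop :=
  [/\ forall k y, measurable (xi C k @^-1` [set y]),
      forall k, measurable_fun setT (m1 C k) /\ measurable_fun setT (m2 C k),
      forall k w, PU (U1 G) (m1 C k w) /\ PU (U2 G) (m2 C k w),
      Pr C (xi C 0 @^-1` [set x]) = 1%E &
      forall n y A, history C n A ->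
        (Pr C (A `&` xi C n.+1 @^-1` [set y]) =
         \int[Pr C]_(w in A) extend G (p G (xi C n w) y) (m1 C n w) (m2 C n w))%E].

(* N = min{n : xi_n \in dS}, with None for N = oo *)
Definition exit_time (R : realType) (S : finType) (G : game R S)
    (C : controlled_chain R S) (w : Omega C) : option nat :=
  if pselect (exists n, xi C n w \in absorbing G) is left h
  then Some (ex_minn h) else None.

Definition total_cost (R : realType) (S : finType) (G : game R S)
    (C : controlled_chain R S) (w : Omega C) : \bar R :=
  let running k := extend G (c G (xi C k w)) (m1 C k w) (m2 C k w) in
  if exit_time G w is Some N
  then (\sum_(0 <= k < N) running k + (g G (xi C N w))%:E)%E
  else (\sum_(0 <= k <oo) running k)%E.

Definition expected_cost (R : realType) (S : finType) (G : game R S)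
    (C : controlled_chain R S) : \bar R :=
  (\int[Pr C]_w total_cost G w)%E.

(* H n (xi_k)_{k <= n} (own controls)_{k < n} (opponent's controls)_{k < n} *)
Definition first_rule (R : realType) (S : finType) :=
  forall n : nat, n.+1.-tuple S ->
    n.-tuple (relaxed R) -> n.-tuple (relaxed R) -> relaxed R.

(* H n (xi_k)_{k <= n} (own controls)_{k < n} (opponent's controls)_{k <= n} *)
Definition last_rule (R : realType) (S : finType) :=
  forall n : nat, n.+1.-tuple S ->
    n.-tuple (relaxed R) -> n.+1.-tuple (relaxed R) -> relaxed R.

(* Gamma_i(1) and Gamma_i(2), for U = U_i.  As S is finite, joint measurability
   is measurability in the control arguments for each fixed s. *)
Definition Gamma_first (R : realType) (S : finType) (U : set R) :
    set (first_rule R S) :=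
  [set H | forall n s,
     measurable_fun setT
       (fun h : n.-tuple (relaxed R) * n.-tuple (relaxed R) => H n s h.1 h.2) /\
     forall own opp, PU U (H n s own opp)].

Definition Gamma_last (R : realType) (S : finType) (U : set R) :
    set (last_rule R S) :=
  [set H | forall n s,
     measurable_fun setT
       (fun h : n.-tuple (relaxed R) * n.+1.-tuple (relaxed R) =>
          H n s h.1 h.2) /\
     forall own opp, PU U (H n s own opp)].

Definition follows_first (R : realType) (S : finType) (H : first_rule R S)
    (T : Type) (xi : nat -> T -> S) (own opp : nat -> T -> relaxed R) : Prop :=
  forall n w, own n w =
    H n [tuple xi k w | k < n.+1] [tuple own k w | k < n] [tuple opp k w | k < n].

Definition follows_last (R : realType) (S : finType) (H : last_rule R S)
    (T : Type) (xi : nat -> T -> S) (own opp : nat -> T -> relaxed R) : Prop :=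
  forall n w, own n w =
    H n [tuple xi k w | k < n.+1] [tuple own k w | k < n]
      [tuple opp k w | k < n.+1].

(* W(x, m_1, m_2) for a pair of rules.  Such a pair and x determine the joint law
   of (xi, m_1, m_2), so the set of costs below is a singleton; [xget] picks its
   element.  In [W_12] player 1 moves first, in [W_21] player 2 does. *)
Definition W_12 (R : realType) (S : finType) (G : game R S) (x : S)
    (H1 : first_rule R S) (H2 : last_rule R S) : \bar R :=
  xget 0%E [set v | exists C : controlled_chain R S,
    [/\ admissible G x C,
        follows_first H1 (xi C) (m1 C) (m2 C),
        follows_last H2 (xi C) (m2 C) (m1 C) &
        v = expected_cost G C]].

Definition W_21 (R : realType) (S : finType) (G : game R S) (x : S)
    (H1 : last_rule R S) (H2 : first_rule R S) : \bar R :=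
  xget 0%E [set v | exists C : controlled_chain R S,
    [/\ admissible G x C,
        follows_last H1 (xi C) (m1 C) (m2 C),
        follows_first H2 (xi C) (m2 C) (m1 C) &
        v = expected_cost G C]].

Definition worst_upper (R : realType) (S : finType) (G : game R S) (x : S)
    (H1 : first_rule R S) : \bar R :=
  ereal_sup [set W_12 G x H1 H2 | H2 in @Gamma_last R S (U2 G)].

Definition V_upper (R : realType) (S : finType) (G : game R S) (x : S) : \bar R :=
  ereal_inf [set worst_upper G x H1 | H1 in @Gamma_first R S (U1 G)].

Definition worst_lower (R : realType) (S : finType) (G : game R S) (x : S)
    (H2 : first_rule R S) : \bar R :=
  ereal_inf [set W_21 G x H1 H2 | H1 in @Gamma_last R S (U1 G)].

Definition V_lower (R : realType) (S : finType) (G : game R S) (x : S) : \bar R :=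
  ereal_sup [set worst_lower G x H2 | H2 in @Gamma_first R S (U2 G)].

(* The outer extremum is attained, by a rule against which the inner one is
   attained too.  The inner extremum need not be attained against an arbitrary
   rule, which may be discontinuous in the opponent's past controls. *)
Definition V_upper_attained (R : realType) (S : finType) (G : game R S)
    (x : S) : Prop :=
  exists H1 H2, [/\ @Gamma_first R S (U1 G) H1, @Gamma_last R S (U2 G) H2,
    worst_upper G x H1 = V_upper G x & W_12 G x H1 H2 = V_upper G x].

Definition V_lower_attained (R : realType) (S : finType) (G : game R S)
    (x : S) : Prop :=
  exists H1 H2, [/\ @Gamma_last R S (U1 G) H1, @Gamma_first R S (U2 G) H2,
    worst_lower G x H2 = V_lower G x & W_21 G x H1 H2 = V_lower G x].

(* Main.v *)
Require Import Defs.
From HB Require Import structures.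
From mathcomp Require Import all_boot all_order all_algebra.
From mathcomp Require Import all_classical all_reals all_analysis.
From mathcomp Require Import measurable_realfun ring lra.
Import Order.TTheory GRing.Theory Num.Theory.
Import numFieldNormedType.Exports.
Set Implicit Arguments.
Unset Strict Implicit.
Unset Printing Implicit Defensive.
Local Open Scope classical_set_scope.
Local Open Scope ring_scope.

(** The value of the game is a fixed point [V] of the Shapley operator, which
sends [V] to [g] on the absorbing set and, at any other state [x], to the value
of the one-stage game with payoff [c x + sum_y V y * p x y].  If [mu1 x] and
[mu2 x] are optimal mixed actions of that one-stage game, the stationary rules
playing them form a saddle point.  Indeed, against [mu1] the cost accumulated so
far plus [V] at the present state is a supermartingale, and against [mu2] it is a
submartingale, whatever the other player knows when choosing, in particular when
the current move of the opponent is known; so the order of the moves is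
immaterial, every cost against [mu1] is at most [V x], every cost against [mu2]
is at least [V x], and all the extrema equal [V x] and are attained by these two
rules.

Four facts carry this.

[minimax_PU] gives the one-stage values.  For each level [v], Blackwell's
approachability strategy either produces finite samples of actions of the first
player whose empirical law nearly guarantees [v], or gets stuck at weights on
actions of the second player which forbid it; this is the dichotomy
[empirical_duality].  Optimal measures are limits of empirical laws: an empirical
law on the line is the image of the uniform distribution by a monotone quantile
function, and monotone functions into a compact set converge pointwise along an
ultrafilter, the integrals being controlled by a comparison with Riemann sums
([empirical_limit]).

[exit_potential] turns the hypothesis on the exit probability, applied to the
Markov policy which maximises the probability of staying alive, into a function
[h >= 1] off the absorbing set whose expected value after one step is at most
[beta * h] with [beta < 1], for all actions.  It bounds value iteration from
above, so that the iterates increase to a fixed point ([shapley_fixpoint]), and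
it makes the probability of survival tend to [0].

[cost_upper] and [cost_lower] are the two martingale inequalities.  The first
drops the nonnegative remainder; the second bounds it through the geometric decay
of [h] along the chain.

[chain_exists] constructs a chain on the unit interval for arbitrary controls
depending on the past states.  It is needed because the cost of a pair of rules
is the default value [0] unless some chain follows these rules, and because the
exit hypothesis speaks of chains. *)

(** * Integration against the uniform distribution on the unit interval *)

Section Unif.
Variable R : realType.
Local Notation lam := (uniform_prob (@ltr01 R)).

Lemma uniform_itv (a b : R) : 0 <= a -> a <= b -> b <= 1 ->
  lam `[a, b[%classic = (b - a)%:E.
Proof.
move=> a0 ab b1; rewrite /uniform_prob.
rewrite (eq_integral (fun=> 1%:E)); last first.
  move=> x; rewrite inE/= in_itv/= => /andP[ax xb].
  rewrite /uniform_pdf (le_trans a0 ax) (le_trans (ltW xb) b1)/=.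
  by rewrite subr0 invr1.
rewrite integral_cst//= mul1e lebesgue_measure_itv/= lte_fin.
by move: ab; rewrite le_eqVlt => /orP[/eqP->|->//]; rewrite ltxx subrr.
Qed.

Lemma uniform_setC_itv : lam (~` `[0, 1[%classic) = 0%E.
Proof.
rewrite probability_setC// [X in (1 - X)%E](_ : _ = 1%E) ?subee//.
by apply: etrans (uniform_itv _ _ _) _; rewrite ?subr0.
Qed.

Lemma integral_uniform_itv (f : R -> \bar R) : measurable_fun setT f ->
  (forall t, 0 <= f t)%E ->
  (\int[lam]_t f t = \int[lam]_(t in `[0%R, 1%R[) f t)%E.
Proof.
move=> mf f0.
rewrite -(setUv `[0%R, 1%R[%classic) ge0_integral_setU//=; last 3 first.
- exact: measurableC.
- by rewrite setUv.
- exact/disj_setPCl.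
rewrite [X in (_ + X)%E](_ : _ = 0%E) ?adde0//.
apply: null_set_integral => //=.
- exact: measurableC.
- exact: measurable_funTS.
- exact: uniform_setC_itv.
Qed.

Local Notation cell J j := `[j%:R / J%:R, j.+1%:R / J%:R[%classic.

Lemma uniform_cell (J j : nat) : (j < J)%N -> lam (cell J j) = (J%:R^-1)%:E.
Proof.
move=> jJ; have J0 : 0 < J%:R :> R by rewrite ltr0n (leq_ltn_trans _ jJ).
rewrite uniform_itv//.
- by rewrite -mulrBl -natrB// subSnn mul1r.
- by rewrite ler_pM2r ?invr_gt0// ler_nat.
- by rewrite ler_pdivrMr// mul1r ler_nat.
Qed.

Lemma integral_uniform_split (f : R -> R) (J : nat) :
  (0 < J)%N -> measurable_fun setT f -> (forall t, 0 <= f t) ->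
  (\int[lam]_t (f t)%:E =
   \sum_(0 <= j < J) \int[lam]_(t in cell J j) (f t)%:E)%E.
Proof.
move=> J0 mf f0.
have JR0 : 0 < J%:R :> R by rewrite ltr0n.
have meas_f D : measurable_fun D (fun t => (f t)%:E).
  by apply/measurable_EFinP; exact: measurable_funTS.
rewrite integral_uniform_itv//.
suff H m : (m <= J)%N -> (\int[lam]_(t in `[0%R, (m%:R / J%:R)%R[) (f t)%:E
    = \sum_(0 <= j < m) \int[lam]_(t in cell J j) (f t)%:E)%E.
  by have := H J (leqnn J); rewrite divff ?gt_eqF.
elim: m => [_|m IH mJ].
  by rewrite mul0r set_itvxx big_geq// integral_set0.
have le01 : 0 <= m%:R / J%:R :> R by rewrite divr_ge0.
have le12 : m%:R / J%:R <= m.+1%:R / J%:R :> R.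
  by rewrite ler_pM2r ?invr_gt0// ler_nat.
have -> : `[0%R, (m.+1%:R / J%:R)[%classic =
    `[0%R, (m%:R / J%:R)[%classic `|` cell J m :> set R.
  apply/seteqP; split => t /=; rewrite !in_itv/=.
    by case: (ltP t (m%:R / J%:R)) => // h /andP[-> ->]; [left|right].
  case=> /andP[t0 tm]; first by rewrite t0/= (lt_le_trans tm).
  by rewrite tm (le_trans le01 t0).
rewrite ge0_integral_setU//=.
- by rewrite big_nat_recr//= IH// ltnW.
- exact: meas_f.
- by move=> x _; rewrite lee_fin.
- apply/disj_setPS => t [] /=; rewrite !in_itv/= => /andP[_ h] /andP[h' _].
  by move: (le_lt_trans h' h); rewrite ltxx.
Qed.

Lemma integral_uniform_le (f : R -> R) (J : nat) (al : nat -> R) :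
  (0 < J)%N -> measurable_fun setT f -> (forall t, 0 <= f t) ->
  (forall j t, (j < J)%N -> j%:R / J%:R <= t < j.+1%:R / J%:R -> f t <= al j) ->
  (\int[lam]_t (f t)%:E <= ((\sum_(0 <= j < J) al j) / J%:R)%:E)%E.
Proof.
move=> J0 mf f0 fal; have JR0 : 0 < J%:R :> R by rewrite ltr0n.
rewrite (integral_uniform_split J0)// mulr_suml -sumEFin !big_nat lee_sum//.
move=> j /andP[_ jJ].
have al0 : 0 <= al j.
  apply: le_trans (f0 (j%:R / J%:R)) (fal _ _ jJ _).
  by rewrite lexx /= ltr_pM2r ?invr_gt0// ltr_nat.
apply: (@le_trans _ _ (\int[lam]_(t in cell J j) (al j)%:E)%E).
  apply: ge0_le_integral => //=.
  - by move=> t _; rewrite lee_fin.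
  - by apply/measurable_EFinP; exact: measurable_funTS.
  - by move=> t; rewrite in_itv/= lee_fin; exact: fal.
by rewrite integral_cst//= [X in (_ * X <= _)%E]uniform_cell.
Qed.

Lemma integral_uniform_ge (f : R -> R) (J : nat) (al : nat -> R) :
  (0 < J)%N -> measurable_fun setT f -> (forall t, 0 <= f t) ->
  (forall j t, (j < J)%N -> j%:R / J%:R <= t < j.+1%:R / J%:R -> al j <= f t) ->
  (((\sum_(0 <= j < J) al j) / J%:R)%:E <= \int[lam]_t (f t)%:E)%E.
Proof.
move=> J0 mf f0 fal; have JR0 : 0 < J%:R :> R by rewrite ltr0n.
rewrite (integral_uniform_split J0)// mulr_suml -sumEFin !big_nat lee_sum//.
move=> j /andP[_ jJ].
apply: (@le_trans _ _ (\int[lam]_(t in cell J j) (Num.max 0 (al j))%:E)%E).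
  rewrite integral_cst//= [X in (_ <= _ * X)%E]uniform_cell// -EFinM lee_fin.
  by rewrite ler_pM2r ?invr_gt0// le_max lexx orbT.
apply: ge0_le_integral => //=.
- by move=> t _; rewrite lee_fin le_max lexx.
- by apply/measurable_EFinP; exact: measurable_funTS.
- by move=> t; rewrite in_itv/= lee_fin ge_max f0/=; exact: fal.
Qed.

End Unif.

(** * Monotone functions: quantiles and Riemann sums *)

(** The point [y] ranges over the whole space, as [h] is continuous everywhere. *)
Lemma unif_cont_compact (R : realType) (T : pseudoMetricType R) (h : T -> R)
    (K : set T) (e : R) : compact K -> continuous h -> 0 < e ->
  exists2 d, 0 < d & forall x y, K x -> ball x d y -> `|h x - h y| < e.
Proof.
move=> /compact_near_coveringP cK ch e0.
have /cK : forall x, K x -> \forall x' \near x & d \near (0 : R)^'+,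
    forall y, ball x' d y -> `|h x' - h y| < e.
  move=> x Kx.
  have e2 : 0 < e / 2 by rewrite divr_gt0.
  have /cvgrPdist_lt /(_ _ e2) /nbhs_ballP[r /= r0 rP] := ch x.
  near=> x' d => y x'y.
  have d2 : d < r / 2 by near: d; apply: nbhs_right_lt; rewrite divr_gt0.
  have xx' : ball x (r / 2) x' by near: x'; apply: nbhsx_ballx; rewrite divr_gt0.
  have h1 : `|h x - h x'| < e / 2.
    by apply: rP; apply: le_ball xx'; rewrite ler_pdivrMr// ler_peMr// ?ltW// ltr1n.
  have h2 : `|h x - h y| < e / 2.
    apply: rP; rewrite [r]splitr; apply: ball_triangle xx' _.
    by apply: le_ball x'y; exact: ltW.
  rewrite [e]splitr (_ : h x' - h y = (h x - h y) - (h x - h x')); last by lra.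
  by apply: le_lt_trans (ler_normB _ _) _; rewrite ltrD.
move=> H.
near (0 : R)^'+ => d.
exists d; first by near: d; exact: nbhs_right_gt.
by move=> x y Kx; move: x Kx y; near: d; exact: H.
Unshelve. all: by end_near. Qed.

Section Quantile.
Variable R : realType.
Implicit Types (s : seq R) (K : set R).

(** For a sorted [s], the quantile function of the uniform law on the entries of
[s], made total by truncating the index, so that it stays monotone on the whole
line. *)
Definition quantile s (t : R) : R :=
  nth 0 s (minn (Num.trunc (t * (size s)%:R)) (size s).-1).

Lemma quantile_mem s t : s != [::] -> quantile s t \in s.
Proof.
by case: s => // x s _; rewrite mem_nth//= ltnS geq_minr.
Qed.

Lemma quantile_nondecreasing s : s != [::] -> sorted <=%R s ->
  {homo quantile s : t u / t <= u}.
Proof.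
case: s => // x s _ ss t u tu; apply: (le_sorted_leq_nth 0 ss).
- by rewrite inE/= ltnS geq_minr.
- by rewrite inE/= ltnS geq_minr.
- by rewrite leq_min geq_minr andbT geq_min le_truncn// ler_wpM2r.
Qed.

Lemma quantile_cell s j (t : R) : (j < size s)%N ->
  j%:R / (size s)%:R <= t < j.+1%:R / (size s)%:R -> quantile s t = nth 0 s j.
Proof.
move=> js; have s0 : 0 < (size s)%:R :> R by rewrite ltr0n (leq_ltn_trans _ js).
rewrite ler_pdivrMr// ltr_pdivlMr// /quantile => /truncn_def ->.
by congr nth; apply/minn_idPl; rewrite -ltnS (ltn_predK js).
Qed.

Local Notation lam := (uniform_prob (@ltr01 R)).

(** The error of the Riemann sum of [h \o Q] does not depend on the monotone
function [Q]: the oscillation of [h \o Q] on a cell is at most [e] plus [C] times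
the increment of [Q], and the increments telescope to at most [2 B]. *)
Lemma monotone_riemann K (Q h : R -> R) (B C e : R) (J : nat) :
  (0 < J)%N -> {homo Q : t u / t <= u} -> (forall t, K (Q t)) ->
  (forall x, K x -> `|x| <= B) -> continuous h -> (forall x, 0 <= h x) ->
  0 <= C ->
  (forall x y, K x -> K y -> `|h x - h y| <= e + C * `|x - y|) ->
  (\int[lam]_t (h (Q t))%:E <=
    ((\sum_(0 <= j < J) h (Q (j%:R / J%:R))) / J%:R
       + (e + C * (B *+ 2) / J%:R))%:E)%E /\
  (((\sum_(0 <= j < J) h (Q (j%:R / J%:R))) / J%:R
       - (e + C * (B *+ 2) / J%:R))%:E <= \int[lam]_t (h (Q t))%:E)%E.
Proof.
move=> J0 ndQ KQ KB ch h0 C0 hC.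
have JR0 : 0 < J%:R :> R by rewrite ltr0n.
have mhQ : measurable_fun setT (h \o Q).
  apply: measurableT_comp; first exact: continuous_measurable_fun.
  exact: nondecreasing_measurable.
pose D j := Q (j.+1%:R / J%:R) - Q (j%:R / J%:R).
have sumD : \sum_(0 <= j < J) (e + C * D j) <= J%:R * e + C * (B *+ 2).
  rewrite big_split/= -mulr_sumr telescope_sumr// sumr_const_nat subn0.
  rewrite -[e *+ J]mulr_natl lerD2l ler_wpM2l//.
  have /ler_normlP[_ b1] := KB _ (KQ (J%:R / J%:R)).
  have /ler_normlP[b0 _] := KB _ (KQ (0 / J%:R)).
  by rewrite mulr2n lerD.
have osc j t : j%:R / J%:R <= t < j.+1%:R / J%:R ->
    `|h (Q t) - h (Q (j%:R / J%:R))| <= e + C * D j.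
  move=> /andP[jt tj]; apply: le_trans (hC _ _ (KQ _) (KQ _)) _.
  rewrite lerD2l ler_wpM2l// ger0_norm ?subr_ge0 ?ndQ// lerD2r.
  by apply: ndQ; exact: ltW.
have sumD' : (\sum_(0 <= j < J) (e + C * D j)) / J%:R <= e + C * (B *+ 2) / J%:R.
  rewrite ler_pdivrMr// mulrDl divfK ?gt_eqF// mulrC.
  by rewrite [X in _ <= X + _]mulrC mulrC.
split.
- apply: le_trans (integral_uniform_le (J := J)
    (al := fun j => h (Q (j%:R / J%:R)) + (e + C * D j)) _ _ _ _) _ => //.
    move=> j t jJ /osc; rewrite ler_distl => /andP[_].
    by rewrite addrC.
  by rewrite lee_fin big_split/= mulrDl lerD2l.
- apply: le_trans (integral_uniform_ge (J := J)
    (al := fun j => h (Q (j%:R / J%:R)) - (e + C * D j)) _ _ _ _) => //.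
    by rewrite lee_fin sumrB mulrBl lerD2l lerN2.
  by move=> j t jJ /osc; rewrite ler_distl => /andP[].
Qed.

Lemma integral_quantile_le s (h : R -> R) : s != [::] -> sorted <=%R s ->
  continuous h -> (forall x, 0 <= h x) ->
  (\int[lam]_t (h (quantile s t))%:E <= ((\sum_(x <- s) h x) / (size s)%:R)%:E)%E.
Proof.
move=> s0 ss ch h0; rewrite (big_nth 0).
apply: integral_uniform_le => //.
- by case: s s0 {ss}.
- apply: measurableT_comp; first exact: continuous_measurable_fun.
  by apply: nondecreasing_measurable => //; exact: quantile_nondecreasing.
- by move=> j t js jt; rewrite (quantile_cell js jt).
Qed.

End Quantile.

(** * Compactness of the probability measures on a compact set of reals *)

Lemma ultra_cvg_compact (R : realType) (U : set_system nat) (K : set R)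
    (u : nat -> R) : UltraFilter U -> compact K -> (forall k, K (u k)) ->
  exists q, K q /\ forall e, 0 < e -> \forall k \near U, `|q - u k| < e.
Proof.
move=> UU cK Ku.
have [q [Kq cq]] : K `&` cluster (u @ U) !=set0.
  by apply: cK; apply: (@filterS _ U _ setT) filterT => k _; exact: Ku.
exists q; split => // e e0.
have [//|nA] := in_ultra_setVsetC [set k | `|q - u k| < e] UU.
have [y [/= ]] := cq (~` ball q e) (ball q e) nA (nbhsx_ballx q e e0).
by [].
Qed.

(** A substitute for weak compactness.  The limit of the quantile functions along
an ultrafilter is monotone, hence measurable, and [mu] is its law.  Dominated
convergence fails along ultrafilters; the uniform Riemann sums of
[monotone_riemann] replace it, since only finitely many points are involved. *)
Lemma empirical_limit (R : realType) (K : set R) (M : R) (s : nat -> seq R) :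
  compact K -> (forall k, s k != [::]) -> (forall k x, x \in s k -> K x) ->
  exists2 mu : relaxed R, PU K mu & forall (h : R -> R) (v : R),
    continuous h -> (forall x, 0 <= h x <= M) ->
    (forall e, 0 < e -> \forall k \near \oo,
       \sum_(x <- s k) h x <= (v + e) * (size (s k))%:R) ->
    (\int[(mu : probability (measurableTypeR R) R)]_(x in K) (h x)%:E <= v%:E)%E.
Proof.
move=> cK s0 sK.
(* Pointwise limits along [U] exist by compactness, without passing to a
   subsequence. *)
have [U [UU ooU]] := @ultraFilterLemma nat \oo _.
pose s' k := sort <=%R (s k).
have s'0 k : s' k != [::] by rewrite -size_eq0 size_sort size_eq0.
have ss' k : sorted <=%R (s' k) by apply: sort_sorted => x y; exact: le_total.
pose Qk k t := quantile (s' k) t.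
have KQk k t : K (Qk k t).
  by apply: (sK k); rewrite -(mem_sort <=%R); exact: quantile_mem.
have ndQk k : {homo Qk k : t u / t <= u} by exact: quantile_nondecreasing.
have /choice[Q QP] := fun t => @ultra_cvg_compact R U K (Qk ^~ t) UU cK (KQk ^~ t).
have KQ t : K (Q t) by have [] := QP t.
have cvQ t e : 0 < e -> \forall k \near U, `|Q t - Qk k t| < e.
  by have [_] := QP t; exact.
have ndQ : {homo Q : t u / t <= u}.
  move=> t u tu; rewrite leNgt; apply/negP => ut.
  have e0 : 0 < (Q t - Q u) / 2 by rewrite divr_gt0// subr_gt0.
  have [k [h1 h2]] := filter_ex (filterI (cvQ t _ e0) (cvQ u _ e0)).
  have := ndQk k _ _ tu; move: h1 h2; rewrite !ltr_distl => /andP[h1 h2] /andP[h3 h4].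
  by lra.
have mQ : measurable_fun setT Q by exact: nondecreasing_measurable.
pose Qm : {mfun measurableTypeR R >-> measurableTypeR R} :=
  HB.pack (Q : measurableTypeR R -> measurableTypeR R)
    (isMeasurableFun.Build _ _ _ _ (Q : measurableTypeR R -> measurableTypeR R) mQ).
have mK : measurable (K : set (measurableTypeR R)).
  by apply: closed_measurable; apply: compact_closed => //; exact: Rhausdorff.
have QK : Qm @^-1` K = setT by apply/seteqP; split => t //= _; exact: KQ.
pose mu : probability (measurableTypeR R) R :=
  distribution (uniform_prob (@ltr01 R)) Qm.
exists (mu : relaxed R).
  rewrite /PU/= /distribution /pushforward; rewrite QK.
  exact: (probability_setT (uniform_prob (@ltr01 R))).
move=> h v ch h0M hv.
have h0 x : 0 <= h x by have /andP[] := h0M x.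
rewrite ge0_integral_pushforward//; last 2 first.
- apply/measurable_EFinP; apply: measurable_funTS.
  exact: continuous_measurable_fun.
- by move=> y _; rewrite lee_fin.
rewrite QK /comp/=.
have [B [Br]] := compact_bounded cK; move=> /(_ (`|B| + 1)) KB.
have {}KB x : K x -> `|x| <= `|B| + 1.
  by apply: KB; rewrite (le_lt_trans (ler_norm _))// ltrDl.
set B1 := `|B| + 1 in KB.
have B10 : 0 <= B1 by rewrite addr_ge0.
apply/lee_addgt0Pr => e e0.
(* Each of the two Riemann sums costs [2 * e6], passing from [Q] to [Qk k] at the
   [J] grid points costs [e6], and so does the hypothesis on [s k]. *)
pose e6 := e / 6; have e60 : 0 < e6 by rewrite divr_gt0.
have [d d0 hd] := unif_cont_compact cK ch e60.
have M0 : 0 <= M by have /andP[/le_trans h1 /h1] := h0M 0.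
pose C := M / d; have C0 : 0 <= C by rewrite divr_ge0// ltW.
have hC x y : K x -> K y -> `|h x - h y| <= e6 + C * `|x - y|.
  move=> Kx Ky; have [xy|xy] := ltP (`|x - y|) d.
    apply: le_trans (ltW (hd x y Kx _)) _; first exact: xy.
    by rewrite lerDl mulr_ge0.
  have : `|h x - h y| <= M.
    by rewrite ler_distl; have := h0M x; have := h0M y; lra.
  move=> /le_trans; apply; rewrite -[leLHS]add0r lerD ?(ltW e60)//.
  by rewrite /C mulrAC ler_pdivlMr// ler_wpM2l.
pose J := (Num.trunc (C * (B1 *+ 2) / e6)).+1.
have J0 : (0 < J)%N by [].
have JP : C * (B1 *+ 2) / J%:R <= e6.
  rewrite ler_pdivrMr ?ltr0n// -ler_pdivrMl// mulrC.
  by have /andP[_ /ltW] := truncn_itv (divr_ge0 (mulr_ge0 C0 (mulrn_wge0 2 B10)) (ltW e60)).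
have [Q1 _] := monotone_riemann J0 ndQ KQ KB ch h0 C0 hC.
have Unear : \forall k \near U, \sum_(x <- s k) h x <= (v + e6) * (size (s k))%:R.
  by apply: ooU; exact: hv.
have Unear2 : \forall k \near U, forall j : 'I_J,
    `|h (Q (j%:R / J%:R)) - h (Qk k (j%:R / J%:R))| < e6.
  apply: filter_forall => j; near=> k; apply: hd => //.
  by near: k; exact: cvQ.
have [k [hk1 hk2]] := filter_ex (filterI Unear Unear2).
have [_ Q2] := monotone_riemann J0 (ndQk k) (KQk k) KB ch h0 C0 hC.
have Q3 := le_trans Q2 (integral_quantile_le (s'0 k) (ss' k) ch h0).
apply: le_trans Q1 _; rewrite -EFinD lee_fin.
move: Q3; rewrite lee_fin size_sort (perm_big _ (permEl (perm_sort _ _)))/=.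
have sk0 : 0 < (size (s k))%:R :> R by rewrite ltr0n lt0n size_eq0 s0.
have hk1' : (\sum_(x <- s k) h x) / (size (s k))%:R <= v + e6 by rewrite ler_pdivrMr.
have : (\sum_(0 <= j < J) h (Q (j%:R / J%:R))) / J%:R <=
    (\sum_(0 <= j < J) h (Qk k (j%:R / J%:R))) / J%:R + e6.
  rewrite ler_pdivrMr ?ltr0n// mulrDl divfK ?gt_eqF ?ltr0n//.
  rewrite mulr_natr -[X in e6 *+ X](subn0 J) -sumr_const_nat -big_split/=.
  rewrite !big_nat ler_sum// => j jJ.
  by have := hk2 (Ordinal jJ); rewrite ltr_distl => /andP[_ /ltW].
rewrite /e6 in JP hk1' *; move: JP hk1'.
by lra.
Unshelve. all: by end_near. Qed.

(** * Approachability and empirical mixed strategies *)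

Lemma sumr_const_seq (R : nmodType) (T : Type) (s : seq T) (x : R) :
  \sum_(i <- s) x = x *+ size s.
Proof. by rewrite big_const_seq iter_addr_0 count_predT. Qed.

(** Approachability of the negative orthant.  Given the sums [x_b] of the past
payoffs, either the payoff vector of some action has a nonpositive inner product
with the positive part [w] of [x], so that the squared distance to the orthant
grows by a bounded amount, or [w] itself is a vector of weights against which
every action has a positive payoff. *)
Lemma blackwell (R : realType) (T T' : eqType) (K : set T)
    (B : seq T') (d : T -> T' -> R) (M : R) :
  K !=set0 -> (forall a b, K a -> `|d a b| <= M) ->
  (exists w : T' -> R, [/\ forall b, 0 <= w b, 0 < \sum_(b <- B) w b &
     forall a, K a -> 0 < \sum_(b <- B) w b * d a b]) \/
  (forall N, exists s : seq T, [/\ size s = N, forall a, a \in s -> K a &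
     \sum_(b <- B) Num.max 0 (\sum_(a <- s) d a b) ^+ 2
       <= N%:R * ((size B)%:R * M ^+ 2)]).
Proof.
move=> [a0 Ka0] dM.
have [|noW] := pselect (exists w : T' -> R, [/\ forall b, 0 <= w b,
    0 < \sum_(b <- B) w b & forall a, K a -> 0 < \sum_(b <- B) w b * d a b]).
  by left.
right; elim=> [|N [s [sN sK sle]]].
  exists [::]; split=> //; rewrite mul0r big1// => b _.
  by rewrite big_nil maxxx expr0n.
pose w b := Num.max 0 (\sum_(a <- s) d a b).
have w0 b : 0 <= w b by rewrite le_max lexx.
have [a Ka wa] : exists2 a, K a & \sum_(b <- B) w b * d a b <= 0.
  apply: contrapT => nex; apply: noW.
  have pos a : K a -> 0 < \sum_(b <- B) w b * d a b.
    by move=> Ka; rewrite ltNge; apply/negP => wa; apply: nex; exists a.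
  exists w; split => //; rewrite lt0r sumr_ge0// andbT psumr_eq0//=.
  apply/negP => /allP B0; move: (pos _ Ka0).
  rewrite big_seq big1 ?ltxx// => b bB.
  by have /eqP -> := B0 b bB; rewrite mul0r.
exists (a :: s); split => /=.
- by rewrite sN.
- by move=> x; rewrite inE => /predU1P[->//|/sK].
apply: (@le_trans _ _ (\sum_(b <- B) (w b ^+ 2 + (w b * d a b) *+ 2 + M ^+ 2))).
  apply: ler_sum => b _; rewrite big_cons.
  have M0 : 0 <= M by apply: le_trans (dM a b Ka).
  have dM2 : d a b ^+ 2 <= M ^+ 2.
    by rewrite -(real_normK (num_real (d a b))) ler_sqr ?nnegrE// dM.
  apply: (@le_trans _ _ ((w b + d a b) ^+ 2)); last first.
    by rewrite sqrrD lerD2l.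
  have [h|h] := leP 0 (d a b + \sum_(a1 <- s) d a1 b).
    have hw : d a b + \sum_(a1 <- s) d a1 b <= w b + d a b.
      by rewrite addrC lerD2r le_max lexx orbT.
    by rewrite ler_sqr ?nnegrE// (le_trans h).
  by rewrite expr0n/= sqr_ge0.
rewrite !big_split/= sumr_const_seq -[M ^+ 2 *+ _]mulr_natl -natr1 mulrDl mul1r lerD2r.
by rewrite -[leRHS]addr0 lerD// -[leRHS]addr0 lerD.
Qed.

Lemma finite_net (R : realType) (K : set R) (d : R) : compact K -> 0 < d ->
  exists2 B : seq R, (forall b, b \in B -> K b) &
    forall b, K b -> exists2 b', b' \in B & `|b - b'| < d.
Proof.
rewrite compact_cover => cK d0.
have [||B BK KB] := cK R K (fun b => ball b d).
- by move=> i _; exact: ball_open.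
- by move=> b Kb; exists b => //; exact: ballxx.
exists (finmap.enum_fset B) => [b bB|b /KB[b' /= b'B bb']].
  by have := BK b bB; rewrite inE.
by exists b' => //; rewrite distrC.
Qed.

(** Finite samples, repetitions allowed, stand for finitely supported mixed
strategies; the slack [e] makes the condition closed in [v]. *)
Definition empirically_le (R : realType) (K1 K2 : set R) (F : R -> R -> R)
    (v : R) :=
  forall e, 0 < e -> exists s : seq R, [/\ s != [::], forall a, a \in s -> K1 a &
    forall b, K2 b -> \sum_(a <- s) F a b <= (v + e) * (size s)%:R].

(** [blackwell] for the payoffs at a finite net of [K2]: the squared distance is
at most a constant times the number of rounds, hence the distance of the averages
tends to [0]. *)
Lemma empirically_le_or_weights (R : realType) (K1 K2 : set R)
    (F : R -> R -> R) (M v : R) :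
  compact K1 -> K1 !=set0 -> compact K2 ->
  continuous (fun r : R * R => F r.1 r.2) -> (forall a b, `|F a b| <= M) ->
  empirically_le K1 K2 F v \/
  (exists B : seq R, exists w : R -> R, [/\ forall b, b \in B -> K2 b,
     forall b, 0 <= w b, 0 < \sum_(b <- B) w b &
     forall a, K1 a -> v * \sum_(b <- B) w b < \sum_(b <- B) w b * F a b]).
Proof.
move=> cK1 K10 cK2 cF FM.
have [|noW] := pselect (exists B : seq R, exists w : R -> R,
    [/\ forall b, b \in B -> K2 b,
     forall b, 0 <= w b, 0 < \sum_(b <- B) w b &
     forall a, K1 a -> v * \sum_(b <- B) w b < \sum_(b <- B) w b * F a b]).
  by right.
left=> e e0; have e20 : 0 < e / 2 by rewrite divr_gt0.
have [d d0 Fd] := unif_cont_compact (compact_setX cK1 cK2) cF e20.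
have [B BK2 netB] := finite_net cK2 d0.
have dM a b : K1 a -> `|F a b - v| <= M + `|v|.
  by move=> _; apply: le_trans (ler_normB _ _) _; rewrite lerD2r.
have [[w [w0 wB wpos]]|bw] := blackwell B K10 dM.
  exfalso; apply: noW; exists B, w; split => // a Ka.
  have := wpos a Ka; under eq_bigr do rewrite mulrBr.
  by rewrite sumrB subr_gt0 -mulr_suml mulrC.
set C := (size B)%:R * (M + `|v|) ^+ 2 in bw.
have C0 : 0 <= C by rewrite mulr_ge0// sqr_ge0.
(* The excess of every sum is at most the root of [N * C], hence below [N * e / 2]. *)
pose N := (Num.trunc (C / (e / 2) ^+ 2)).+1.
have CN : C < N%:R * (e / 2) ^+ 2.
  rewrite -ltr_pdivrMr ?exprn_gt0//.
  by have /andP[] := truncn_itv (divr_ge0 C0 (sqr_ge0 (e / 2))).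
have [s [sN sK sle]] := bw N.
exists s; split => //; first by rewrite -size_eq0 sN.
move=> b K2b; have [b' b'B bb'] := netB b K2b; rewrite sN.
set y := \sum_(a <- s) (F a b' - v).
have yle : y <= N%:R * (e / 2).
  rewrite leNgt; apply/negP => ylt.
  have y0 : 0 < y by apply: le_lt_trans ylt; rewrite mulr_ge0// ltW.
  have : y ^+ 2 <= N%:R * C.
    apply: le_trans sle; rewrite (big_rem b')//= -/y.
    rewrite (_ : Num.max 0 y = y) ?lerDl ?sumr_ge0//.
      by move=> *; exact: sqr_ge0.
    by apply/max_idPr; exact: ltW.
  apply/negP; rewrite -ltNge.
  apply: (@lt_trans _ _ (N%:R * (N%:R * (e / 2) ^+ 2))).
    by rewrite ltr_pM2l ?ltr0n.
  rewrite mulrA -expr2 -exprMn ltr_sqr ?nnegrE//; last exact: ltW.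
  by rewrite mulr_ge0// ltW.
apply: (@le_trans _ _ (\sum_(a <- s) ((F a b' - v) + (v + e / 2)))).
  rewrite !big_seq; apply: ler_sum => a /sK K1a.
  have := Fd (a, b) (a, b') (conj K1a K2b).
  rewrite ltr_distl => /(_ _)/andP[|_ /ltW]; last by lra.
  by split => //=; exact: ballxx.
rewrite big_split/= sumr_const_seq sN -/y -[_ *+ N]mulr_natr.
rewrite mulrC in yle; apply: le_trans (lerD yle (lexx _)) _.
by rewrite -mulrDl ler_wpM2r//; lra.
Qed.

(** * The minimax theorem on two compact sets of reals *)

Section Continuous2.
Variables (R : realType) (F : R -> R -> R).
Hypothesis cF : continuous (fun r : R * R => F r.1 r.2).

Lemma continuous_slice1 b : continuous (F ^~ b).
Proof.
move=> a; apply: (@continuous2_cvg _ _ _ _ _ _ id (cst b) F a b).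
- exact: (@cF (a, b)).
- exact: cvg_id.
- exact: cvg_cst.
Qed.

Lemma continuous_slice2 a : continuous (F a).
Proof.
move=> b; apply: (@continuous2_cvg _ _ _ _ _ _ (cst a) id F a b).
- exact: (@cF (a, b)).
- exact: cvg_cst.
- exact: cvg_id.
Qed.

Lemma continuous_swap : continuous (fun r : R * R => F r.2 r.1).
Proof.
move=> [a b]; apply: (@continuous2_cvg _ _ _ _ _ _ snd fst F b a).
- exact: (@cF (b, a)).
- exact: cvg_snd.
- exact: cvg_fst.
Qed.
End Continuous2.

(** Weights blocking both players at the same level contradict each other, on
summing the payoffs against the product weights. *)
Lemma empirical_duality (R : realType) (K1 K2 : set R)
    (F : R -> R -> R) (M v : R) :
  compact K1 -> K1 !=set0 -> compact K2 -> K2 !=set0 ->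
  continuous (fun r : R * R => F r.1 r.2) -> (forall a b, `|F a b| <= M) ->
  empirically_le K1 K2 F v \/ empirically_le K2 K1 (fun b a => - F a b) (- v).
Proof.
move=> cK1 K10 cK2 K20 cF FM.
have cF' : continuous (fun r : R * R => - F r.2 r.1).
  by move=> r; apply: continuousN; exact: continuous_swap.
have FM' b a : `|- F a b| <= M by rewrite normrN.
have [|[B [w [BK2 w0 wB wP]]]] := empirically_le_or_weights v cK1 K10 cK2 cF FM.
  by left.
have [|[A [u [AK1 u0 uA uP]]]] :=
    @empirically_le_or_weights _ _ _ (fun b a => - F a b) M (- v) cK2 K20 cK1 cF' FM'.
  by right.
exfalso.
pose p a b := u a * (w b * (F a b - v)).
have h1 a : a \in A -> 0 <= u a * (\sum_(b <- B) w b * (F a b - v)).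
  move=> /AK1/wP; under [X in _ -> _ <= _ * X]eq_bigr do rewrite mulrBr.
  by rewrite sumrB -mulr_suml mulrC => /ltW h; rewrite mulr_ge0// subr_ge0.
have h2 b : b \in B -> 0 <= w b * (\sum_(a <- A) u a * (v - F a b)).
  move=> /BK2/uP; under [X in _ -> _ <= _ * X]eq_bigr do rewrite addrC mulrDr.
  rewrite big_split/= -mulr_suml [X in _ + X]mulrC mulNr => /ltW h.
  by rewrite mulr_ge0// -lerBlDr sub0r.
have [b0 b0B wb0] : exists2 b, b \in B & 0 < w b.
  apply: contrapT => nex; move: wB; rewrite big_seq big1 ?ltxx// => b bB.
  apply/eqP; rewrite eq_le w0 andbT leNgt; apply/negP => wb; apply: nex.
  by exists b.
have h3 : 0 < \sum_(b <- B) w b * (\sum_(a <- A) u a * (v - F a b)).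
  rewrite lt0r big_seq sumr_ge0// andbT psumr_eq0//.
  apply/negP => /allP/(_ b0 b0B); rewrite b0B/= mulf_eq0 gt_eqF//= => /eqP.
  have := uP b0 (BK2 _ b0B); rewrite -subr_gt0.
  under [X in _ -> X = _ -> _]eq_bigr do rewrite addrC mulrDr.
  rewrite big_split/= -mulr_suml [X in _ -> _ + X = _ -> _]mulrC mulNr opprK.
  by move=> /[swap] ->; rewrite ltxx.
have h4 : 0 <= \sum_(a <- A) u a * (\sum_(b <- B) w b * (F a b - v)).
  by rewrite big_seq sumr_ge0.
have := ltr_wpDr h4 h3; rewrite (_ : _ + _ = 0) ?ltxx//.
under eq_bigr do rewrite mulr_sumr.
under [X in _ + X]eq_bigr do rewrite mulr_sumr.
rewrite [X in _ + X]exchange_big/= -big_split/= big1// => b _.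
by rewrite -big_split/= big1// => a _; lra.
Qed.

(** Ville's minimax theorem.  [v] is the supremum of the levels which the second
player can nearly guarantee; by [empirical_duality] the first player can nearly
guarantee every larger level, and [empirical_limit] removes the slack. *)
Theorem minimax_PU (R : realType) (K1 K2 : set R) (F : R -> R -> R) (M : R) :
  compact K1 -> K1 !=set0 -> compact K2 -> K2 !=set0 ->
  continuous (fun r : R * R => F r.1 r.2) -> (forall a b, 0 <= F a b <= M) ->
  exists v : R, exists mu1 mu2 : relaxed R, [/\ PU K1 mu1, PU K2 mu2,
    (forall b, K2 b -> (\int[(mu1 : probability (measurableTypeR R) R)]_(a in K1)
       (F a b)%:E <= v%:E)%E) &
    (forall a, K1 a -> (v%:E <= \int[(mu2 : probability (measurableTypeR R) R)]_(b in K2)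
       (F a b)%:E)%E)].
Proof.
move=> cK1 K10 cK2 K20 cF F0M.
have FM a b : `|F a b| <= M by rewrite ler_norml; have := F0M a b; lra.
have dual v := empirical_duality v cK1 K10 cK2 K20 cF FM.
pose E2 := [set v | empirically_le K2 K1 (fun b a => - F a b) (- v)].
have E2sup : has_sup E2.
  split.
    have [b Kb] := K20; exists 0 => e e0; exists [:: b]; split => //=.
      by move=> x; rewrite inE => /eqP ->.
    move=> a Ka; rewrite big_seq1 mulr1; have := F0M a b; lra.
  exists (M + 1) => v /(_ 1 ltr01)[s [s0 sK sP]].
  have [a Ka] := K10; have := sP a Ka.
  have : \sum_(b <- s) - M <= \sum_(b <- s) - F a b.
    by apply: ler_sum => b _; rewrite lerN2; have := F0M a b; lra.
  move=> /le_trans h /h; rewrite sumr_const_seq -[- M *+ _]mulr_natr ler_pM2r; first by lra.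
  by rewrite ltr0n lt0n size_eq0.
pose v := sup E2.
have E2v : E2 v.
  move=> e e0; have e20 : 0 < e / 2 by rewrite divr_gt0.
  have [u E2u uv] := sup_adherent e20 E2sup.
  have [s [s0 sK sP]] := E2u _ e20; exists s; split => // a Ka.
  apply: le_trans (sP a Ka) _; rewrite ler_wpM2r//.
  by move: uv; rewrite -/v; lra.
have E1v : empirically_le K1 K2 F v.
  move=> e e0; have e20 : 0 < e / 2 by rewrite divr_gt0.
  have [/(_ _ e20)[s [s0 sK sP]]|E2v'] := dual (v + e / 2); last first.
    have := ub_le_sup E2sup.2 E2v'; rewrite -/v => h; exfalso.
    by move: h e20; lra.
  exists s; split => // b Kb; apply: le_trans (sP b Kb) _.
  by rewrite ler_wpM2r//; lra.
exists v.
have k0 (k : nat) : 0 < k.+1%:R^-1 :> R by rewrite invr_gt0 ltr0n.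
have neark (e : R) : 0 < e -> \forall k \near \oo, k.+1%:R^-1 <= e.
  move=> e0; near=> k; apply/ltW.
  by near: k; exact: near_infty_natSinv_lt (PosNum e0).
have /choice[s1 s1P] := fun k => E1v _ (k0 k).
have /choice[s2 s2P] := fun k => E2v _ (k0 k).
have [mu1 PU1 mu1P] := @empirical_limit _ K1 M s1 cK1
  (fun k => let: And3 h _ _ := s1P k in h) (fun k => let: And3 _ h _ := s1P k in h).
have [mu2 PU2 mu2P] := @empirical_limit _ K2 M s2 cK2
  (fun k => let: And3 h _ _ := s2P k in h) (fun k => let: And3 _ h _ := s2P k in h).
exists mu1, mu2; split => //.
- move=> b Kb; apply: mu1P => //; first exact: continuous_slice1.
  move=> e /neark; apply: filterS => k ke.
  have [_ _ /(_ b Kb) /le_trans] := s1P k; apply.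
  by rewrite ler_wpM2r// lerD2l.
- move=> a Ka.
  have cFa : continuous (F a) by exact: continuous_slice2.
  (* [empirical_limit] bounds integrals from above: it is applied to [M - F a]. *)
  have cMF : continuous (fun b : R => M - F a b).
    by move=> b; apply: continuousB; [exact: cvg_cst|exact: cFa].
  have h : (\int[(mu2 : probability (measurableTypeR R) R)]_(b in K2)
       (M - F a b)%:E <= (M - v)%:E)%E.
    apply: mu2P => //.
      by move=> b; have := F0M a b; lra.
    move=> e /neark; apply: filterS => k ke.
    have [_ _ /(_ a Ka) h] := s2P k.
    rewrite big_split/= sumr_const_seq -[M *+ _]mulr_natr -addrA mulrDl lerD2l.
    by apply: le_trans h _; rewrite ler_wpM2r// lerD2l.
  have mK2 : measurable (K2 : set (measurableTypeR R)) by exact: compact_measurable.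
  have mF : measurable_fun (K2 : set (measurableTypeR R)) (fun b => (F a b)%:E).
    apply/measurable_EFinP; apply: measurable_funTS.
    exact: continuous_measurable_fun.
  have sum : (\int[(mu2 : probability (measurableTypeR R) R)]_(b in K2) (F a b)%:E +
     \int[(mu2 : probability (measurableTypeR R) R)]_(b in K2) (M - F a b)%:E = M%:E)%E.
    rewrite -ge0_integralD//.
    + under eq_integral do rewrite -EFinD addrC subrK.
      by rewrite integral_cst//= [X in (_ * X)%E]PU2 mule1.
    + by move=> b _; rewrite lee_fin; have := F0M a b; lra.
    + by move=> b _; rewrite lee_fin; have := F0M a b; lra.
    + by apply/measurable_EFinP; apply: measurable_funB => //; exact/measurable_EFinP.
  have : (M%:E <= \int[(mu2 : probability (measurableTypeR R) R)]_(b in K2) (F a b)%:E + (M - v)%:E)%E.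
    by rewrite -sum leeD2l.
  by rewrite EFinB addeA leeBrDr// addeC leeD2lE.
Unshelve. all: by end_near. Qed.

(** * Continuous functions on the plane *)

Section ProductBorel.
Variable R : realType.
Local Notation T := (measurableTypeR R).

(** An open set of the plane is a union of squares with rational centres. *)
Lemma open_measurable_prod (O : set (R * R)) :
  open O -> measurable (O : set (T * T)).
Proof.
move=> oO.
pose box (i : rat * rat * nat) : set (R * R) :=
  ball (ratr i.1.1 : R) i.2.+1%:R^-1 `*` ball (ratr i.1.2 : R) i.2.+1%:R^-1.
pose F i := if pselect (box i `<=` O) then box i else set0.
have -> : O = \bigcup_i F i.
  apply/seteqP; split => [[x y] Oxy|z [i _]]; last first.
    by rewrite /F; case: pselect => // sub /sub.
  have /nbhs_ballP[e /= e0 eO] : nbhs (x, y) O by exact: open_nbhs_nbhs.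
  near \oo => n.
  have ne : n.+1%:R^-1 < e / 2.
    near: n; exact: (near_infty_natSinv_lt (PosNum (divr_gt0 e0 (ltr0n _ 2)))).
  have n0 : 0 < n.+1%:R^-1 :> R by rewrite invr_gt0 ltr0n.
  have ratP (u : R) : exists q : rat, ball (ratr q : R) n.+1%:R^-1 u.
    have [|q] := @rat_in_itvoo R (u - n.+1%:R^-1) (u + n.+1%:R^-1).
      by rewrite ltrD2l gtrN.
    rewrite in_itv/= => /andP[q1 q2]; exists q.
    move: q1 q2; rewrite -ball_normE/= ltr_distl.
    by move: (n.+1%:R^-1) => d q1 q2; apply/andP; split; lra.
  have tri (z u v : R) : ball z n.+1%:R^-1 u -> ball z n.+1%:R^-1 v -> ball u e v.
    rewrite -!ball_normE/= => h1 h2.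
    rewrite (_ : u - v = (z - v) - (z - u)); last by lra.
    rewrite [e]splitr (le_lt_trans (ler_normB _ _))//.
    by rewrite ltrD// (lt_trans _ ne).
  have [q qx] := ratP x; have [q' qy] := ratP y.
  exists (q, q', n) => //; rewrite /F; case: pselect => [_|nsub]//.
  exfalso; apply: nsub => -[a b] [/= qa qb]; apply: eO.
  by split; [exact: tri qx qa|exact: tri qy qb].
apply: countable_bigcupT_measurable; first exact: countableP.
move=> i; rewrite /F; case: pselect => sub; last exact: measurable0.
by apply: measurableX; apply: open_measurable; exact: ball_open.
Unshelve. all: by end_near. Qed.

Lemma continuous_measurable_fun2 (f : R * R -> R) : continuous f ->
  measurable_fun [set: T * T] f.
Proof.
move=> cf; apply: (measurability (@RGenOInfty.G R)).
  exact: RGenOInfty.measurableE.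
move=> _ [_ [a ->] <-]; rewrite setTI; apply: open_measurable_prod.
by apply: open_comp => [x _|]; [exact: cf|exact: interval_open].
Qed.

(** Tietze's theorem, followed by truncation at [0]. *)
Lemma continuous_extension_prod (K1 K2 : set R) (f : R -> R -> R) :
  compact K1 -> K1 !=set0 -> compact K2 -> K2 !=set0 ->
  {within K1 `*` K2, continuous (fun r : R * R => f r.1 r.2)} ->
  (forall a b, K1 a -> K2 b -> 0 <= f a b) ->
  exists F : R -> R -> R, exists M : R,
    [/\ continuous (fun r : R * R => F r.1 r.2), forall a b, 0 <= F a b <= M &
        forall a b, K1 a -> K2 b -> F a b = f a b].
Proof.
move=> cK1 [a0 Ka0] cK2 [b0 Kb0] cf f0.
have cK := compact_setX cK1 cK2.
have K0 : K1 `*` K2 !=set0 by exists (a0, b0).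
have [[a b] _ maxf] := compact_EVT_max K0 cK cf.
(* Tietze's theorem asks for a positive bound. *)
pose M := Num.max 1 (f a b).
have M0 : 0 < M by rewrite lt_max ltr01.
have clK : closed (K1 `*` K2 : set (R * R)).
  by apply: compact_closed => //; exact: norm_hausdorff.
have fM r : (K1 `*` K2) r -> `|f r.1 r.2| <= M.
  move=> Kr; rewrite ger0_norm; last by case: Kr; exact: f0.
  by rewrite le_max orbC (maxf r)// inE.
have [g [fg cg gM]] := continuous_bounded_extension
  (@pseudometric_normal R (R * R)%type) clK M0 cf fM.
exists (fun a b => Num.max 0 (g (a, b))), M; split.
- have -> : (fun r : R * R => Num.max 0 (g (r.1, r.2))) =
      (fun r => Num.max 0 (g r)) by apply/funext => -[].
  move=> r; apply: continuous_max; first exact: cst_continuous.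
  exact: cg.
- by move=> x y; rewrite le_max lexx/= ge_max (ltW M0) (le_trans (ler_norm _)).
- move=> x y Kx Ky; rewrite -fg/=; last by rewrite inE.
  by apply/max_idPr; exact: f0.
Qed.

End ProductBorel.

(** * Payoffs averaged over two independent measures *)

Section Extension.
Variables (R : realType) (K1 K2 : set R).
Local Notation T := (measurableTypeR R).
Local Notation P := (probability T R).
Hypothesis mK1 : measurable (K1 : set T).
Hypothesis mK2 : measurable (K2 : set T).
Implicit Types (f : R -> R -> R) (mu nu : relaxed R).
Local Open Scope ereal_scope.

(** The function called [extend] in the game, for arbitrary action sets. *)
Definition ext f mu nu : \bar R :=
  \int[(mu : P)]_(r1 in K1) \int[(nu : P)]_(r2 in K2) (f r1 r2)%:E.

(** Extension by [0] to the plane: the iterated integrals over [K1] and [K2] are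
then integrals over the whole product, where the theorems of Fubini and Tonelli
apply. *)
Definition restr f : T * T -> \bar R :=
  (fun r => (f r.1 r.2)%:E) \_ (K1 `*` K2).

Definition payoff f := measurable_fun [set: T * T] (restr f) /\
  forall a b, K1 a -> K2 b -> (0 <= f a b)%R.

Lemma restr_ge0 f r : payoff f -> 0 <= restr f r.
Proof.
move=> [_ f0]; rewrite /restr patchE; case: ifPn => // /set_mem[h1 h2].
by rewrite lee_fin f0.
Qed.

Lemma restr_in f a b : K1 a -> K2 b -> restr f (a, b) = (f a b)%:E.
Proof. by move=> Ka Kb; rewrite /restr patchE mem_set. Qed.

Lemma restr_out1 f a b : ~ K1 a -> restr f (a, b) = 0.
Proof.
by move=> Ka; rewrite /restr patchE memNset// => -[].
Qed.

Lemma restr_out2 f a b : ~ K2 b -> restr f (a, b) = 0.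
Proof.
by move=> Kb; rewrite /restr patchE memNset// => -[].
Qed.

Lemma restr_inner1 f nu a : K1 a ->
  \int[(nu : P)]_(b in K2) (f a b)%:E = \int[(nu : P)]_b restr f (a, b).
Proof.
move=> Ka; rewrite [LHS]integral_mkcond; apply: eq_integral => b _.
rewrite patchE; case: ifPn => [/set_mem Kb|/negP Kb]; first by rewrite restr_in.
by rewrite restr_out2// => /mem_set.
Qed.

Lemma restr_inner2 f mu b : K2 b ->
  \int[(mu : P)]_(a in K1) (f a b)%:E = \int[(mu : P)]_a restr f (a, b).
Proof.
move=> Kb; rewrite [LHS]integral_mkcond; apply: eq_integral => a _.
rewrite patchE; case: ifPn => [/set_mem Ka|/negP Ka]; first by rewrite restr_in.
by rewrite restr_out1// => /mem_set.
Qed.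

Lemma ext_restr f mu nu :
  ext f mu nu = \int[(mu : P)]_a \int[(nu : P)]_b restr f (a, b).
Proof.
rewrite /ext [LHS]integral_mkcond; apply: eq_integral => a _.
rewrite patchE; case: ifPn => [/set_mem Ka|/negP Ka]; first exact: restr_inner1.
by rewrite integral0_eq// => b _; rewrite restr_out1// => /mem_set.
Qed.

Lemma ext_restr_swap f mu nu : payoff f ->
  ext f mu nu = \int[(nu : P)]_b \int[(mu : P)]_a restr f (a, b).
Proof.
move=> pf; rewrite ext_restr fubini_tonelli//; first by have [] := pf.
by move=> r; exact: restr_ge0.
Qed.

Lemma ext_prod f mu nu : payoff f ->
  ext f mu nu = \int[(mu : P) \x (nu : P)]_r restr f r.
Proof.
move=> pf; rewrite ext_restr fubini_tonelli1//; first by have [] := pf.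
by move=> r; exact: restr_ge0.
Qed.

Lemma ext_ge0 f mu nu : payoff f -> 0 <= ext f mu nu.
Proof.
by move=> pf; rewrite ext_prod// integral_ge0// => r _; exact: restr_ge0.
Qed.

Lemma eq_ext f g mu nu : (forall a b, K1 a -> K2 b -> f a b = g a b) ->
  ext f mu nu = ext g mu nu.
Proof.
move=> fg; rewrite /ext; apply: eq_integral => a /set_mem Ka.
by apply: eq_integral => b /set_mem Kb; rewrite fg.
Qed.

Lemma restrD f g : restr (fun a b => f a b + g a b)%R = restr f \+ restr g.
Proof.
by apply/funext => -[a b]; rewrite /restr/= !patchE; case: ifP => //=; rewrite adde0.
Qed.

Lemma restrZ k f : restr (fun a b => k * f a b)%R = (fun r => k%:E * restr f r).
Proof.
by apply/funext => -[a b]; rewrite /restr/= !patchE; case: ifP => //=; rewrite mule0.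
Qed.

Lemma payoffD f g : payoff f -> payoff g -> payoff (fun a b => f a b + g a b)%R.
Proof.
move=> [mf f0] [mg g0]; split; last by move=> a b Ka Kb; rewrite addr_ge0 ?f0 ?g0.
by rewrite restrD; exact: emeasurable_funD.
Qed.

Lemma payoffZ k f : (0 <= k)%R -> payoff f -> payoff (fun a b => k * f a b)%R.
Proof.
move=> k0 [mf f0]; split; last by move=> a b Ka Kb; rewrite mulr_ge0 ?f0.
by rewrite restrZ; exact: measurable_funeM.
Qed.

Lemma payoff_cst (k : R) : (0 <= k)%R -> payoff (fun _ _ => k).
Proof.
move=> k0; split=> //; rewrite /restr.
by apply/(measurable_restrictT _ _).1 => //; exact: measurableX.
Qed.

Lemma payoff_sum (I : Type) (s : seq I) (f : I -> R -> R -> R) :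
  (forall i, payoff (f i)) -> payoff (fun a b => \sum_(i <- s) f i a b)%R.
Proof.
move=> pf; elim: s => [|i s IH].
  rewrite (_ : (fun a b => _) = (fun _ _ => 0%R)); first exact: payoff_cst.
  by apply/funext => a; apply/funext => b; rewrite big_nil.
rewrite (_ : (fun a b => _) = (fun a b => f i a b + \sum_(i <- s) f i a b)%R).
  exact: payoffD.
by apply/funext => a; apply/funext => b; rewrite big_cons.
Qed.

Lemma extD f g mu nu : payoff f -> payoff g ->
  ext (fun a b => f a b + g a b)%R mu nu = ext f mu nu + ext g mu nu.
Proof.
move=> pf pg; rewrite !ext_prod//; last exact: payoffD.
rewrite restrD ge0_integralD//.
- by move=> r _; exact: restr_ge0.
- by have [] := pf.
- by move=> r _; exact: restr_ge0.
- by have [] := pg.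
Qed.

Lemma extZ k f mu nu : (0 <= k)%R -> payoff f ->
  ext (fun a b => k * f a b)%R mu nu = k%:E * ext f mu nu.
Proof.
move=> k0 pf; rewrite !ext_prod//; last exact: payoffZ.
rewrite restrZ ge0_integralZl//.
- by have [] := pf.
- by move=> r _; exact: restr_ge0.
Qed.

Lemma ext_cst (k : R) mu nu : PU K1 mu -> PU K2 nu ->
  ext (fun _ _ => k) mu nu = k%:E.
Proof.
move=> PU1 PU2; rewrite /ext; under eq_integral do
  rewrite integral_cst//= [X in _ * X]PU2 mule1.
by rewrite integral_cst//= [X in _ * X]PU1 mule1.
Qed.

Lemma ext_sum (I : Type) (s : seq I) (f : I -> R -> R -> R) mu nu :
  PU K1 mu -> PU K2 nu -> (forall i, payoff (f i)) ->
  ext (fun a b => \sum_(i <- s) f i a b)%R mu nu =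
  \sum_(i <- s) ext (f i) mu nu.
Proof.
move=> PU1 PU2 pf; elim: s => [|i s IH].
  rewrite big_nil -[RHS]/(0%R%:E) -(ext_cst 0 PU1 PU2); apply: eq_ext => a b _ _.
  by rewrite big_nil.
rewrite big_cons -IH -extD//; last exact: payoff_sum.
by apply: eq_ext => a b _ _; rewrite big_cons.
Qed.

(** The order of integration is exchanged: the hypothesis bounds the inner
integral over the action of the first player. *)
Lemma ext_le f mu nu (v : R) : payoff f -> (0 <= v)%R -> PU K2 nu ->
  (forall b, K2 b -> \int[(mu : P)]_(a in K1) (f a b)%:E <= v%:E) ->
  ext f mu nu <= v%:E.
Proof.
move=> pf v0 PU2 fv; rewrite ext_restr_swap//.
rewrite (_ : v%:E = \int[(nu : P)]_b (cst v%:E) b); last first.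
  by rewrite integral_cst//= [X in _ * X](probability_setT (nu : P)) mule1.
apply: ge0_le_integral => //.
- by move=> b _; apply: integral_ge0 => a _; exact: restr_ge0.
- apply: (@measurable_fun_fubini_tonelli_G _ _ T T R (mu : P) (restr f)).
    by have [] := pf.
  by move=> r; exact: restr_ge0.
- move=> b _; have [Kb|Kb] := pselect (K2 b).
    by rewrite -restr_inner2// fv.
  by rewrite integral0_eq// => a _; rewrite restr_out2.
Qed.

Lemma ext_ge f mu nu (v : R) : payoff f -> (0 <= v)%R -> PU K1 mu ->
  (forall a, K1 a -> v%:E <= \int[(nu : P)]_(b in K2) (f a b)%:E) ->
  v%:E <= ext f mu nu.
Proof.
move=> pf v0 PU1 fv; rewrite /ext.
rewrite (_ : v%:E = \int[(mu : P)]_(a in K1) (cst v%:E) a); last first.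
  by rewrite integral_cst//= [X in _ * X]PU1 mule1.
apply: ge0_le_integral => //.
apply: (eq_measurable_fun (fun a => \int[(nu : P)]_b restr f (a, b))).
  by move=> a /set_mem Ka; rewrite restr_inner1.
apply: measurable_funTS.
apply: (@measurable_fun_fubini_tonelli_F _ _ T T R (nu : P) (restr f)).
  by have [] := pf.
by move=> r; exact: restr_ge0.
Qed.

Lemma le_ext f g mu nu : payoff f -> payoff g ->
  (forall a b, K1 a -> K2 b -> (f a b <= g a b)%R) ->
  ext f mu nu <= ext g mu nu.
Proof.
move=> pf pg fg; rewrite !ext_prod//; apply: ge0_le_integral => //.
- by move=> r _; exact: restr_ge0.
- by have [] := pf.
- by have [] := pg.
- move=> [a b] _; rewrite /restr !patchE; case: ifPn => // /set_mem[Ka Kb].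
  by rewrite lee_fin fg.
Qed.

(** Random measures are kernels, and integration against a kernel preserves
measurability; it is applied twice. *)
Lemma measurable_ext f d (Om : measurableType d) (m1 m2 : Om -> relaxed R) :
  payoff f -> measurable_fun [set: Om] m1 -> measurable_fun [set: Om] m2 ->
  measurable_fun [set: Om] (fun w => ext f (m1 w) (m2 w)).
Proof.
move=> pf mm1 mm2; under eq_fun do rewrite ext_restr.
pose m2' := fun z : Om * T => m2 z.1.
have mm2' : measurable_fun [set: Om * T] m2' by exact: measurableT_comp.
have mr : measurable_fun [set: (Om * T) * T] (fun z => restr f (z.1.2, z.2)).
  apply: measurableT_comp; first by have [] := pf.
  apply: measurable_fun_pair => //.
  exact: measurableT_comp.
have inner := measurable_fun_integral_finite_kernel
  (fun z : (Om * T) * T => restr f (z.1.2, z.2)) (kprobability mm2')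
  (fun z => restr_ge0 (z.1.2, z.2) pf) mr.
have := measurable_fun_integral_finite_kernel
  (fun z : Om * T => \int[(m2' z : P)]_y restr f (z.2, y)) (kprobability mm1)
  _ inner.
apply => z; apply: integral_ge0 => y _; exact: restr_ge0.
Qed.

Lemma PU_dirac (K : set R) (a : R) : K a ->
  PU K (@dirac _ T a R : relaxed R).
Proof. by move=> Ka; rewrite /PU/= diracE mem_set. Qed.

Lemma ext_dirac f (a b : R) : payoff f -> K1 a -> K2 b ->
  ext f (@dirac _ T a R : relaxed R) (@dirac _ T b R : relaxed R) = (f a b)%:E.
Proof.
move=> pf Ka Kb; rewrite ext_restr integral_dirac//=.
- rewrite diracT mul1e integral_dirac//=; first by rewrite diracT mul1e restr_in.
  apply: (measurableT_comp (f := restr f)); first by have [] := pf.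
  exact: measurable_fun_pair.
- apply: (@measurable_fun_fubini_tonelli_F _ _ T T R _ (restr f)).
    by have [] := pf.
  by move=> r; exact: restr_ge0.
Qed.

End Extension.

(** * Values of continuous one-stage games *)

Section Value.
Variables (R : realType) (K1 K2 : set R).
Hypotheses (cK1 : compact K1) (K10 : K1 !=set0).
Hypotheses (cK2 : compact K2) (K20 : K2 !=set0).
Local Notation T := (measurableTypeR R).
Implicit Types (f : R -> R -> R) (v : R).

Let mK1 : measurable (K1 : set T). Proof. exact: compact_measurable. Qed.
Let mK2 : measurable (K2 : set T). Proof. exact: compact_measurable. Qed.

Definition continuous_on f :=
  {within K1 `*` K2, continuous (fun r : R * R => f r.1 r.2)}.

Lemma continuous_payoff f : continuous_on f ->
  (forall a b, K1 a -> K2 b -> 0 <= f a b) -> payoff K1 K2 f.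
Proof.
move=> cf f0; split=> //.
have [F [M [cF _ Ff]]] := continuous_extension_prod cK1 K10 cK2 K20 cf f0.
have -> : restr K1 K2 f = restr K1 K2 F.
  apply/funext => -[a b]; rewrite /restr !patchE; case: ifPn => // /set_mem[Ka Kb].
  by rewrite /= Ff.
apply/(measurable_restrictT _ _).1; first exact: measurableX.
apply: measurable_funTS; apply/measurable_EFinP.
exact: continuous_measurable_fun2.
Qed.

(** The two measures guarantee [v] against mixed actions, not only pure ones, as
the opponents of the Markov game use mixed actions. *)
Definition is_value f v (mu1 mu2 : relaxed R) :=
  [/\ PU K1 mu1, PU K2 mu2,
      forall nu, PU K2 nu -> (ext K1 K2 f mu1 nu <= v%:E)%E &
      forall mu, PU K1 mu -> (v%:E <= ext K1 K2 f mu mu2)%E].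

Lemma value_exists f : continuous_on f ->
  (forall a b, K1 a -> K2 b -> 0 <= f a b) ->
  exists v mu1 mu2, 0 <= v /\ is_value f v mu1 mu2.
Proof.
move=> cf f0.
have [F [M [cF F0M Ff]]] := continuous_extension_prod cK1 K10 cK2 K20 cf f0.
have [v [mu1 [mu2 [PU1 PU2 le1 ge2]]]] := minimax_PU cK1 K10 cK2 K20 cF F0M.
have v0 : 0 <= v.
  have [b Kb] := K20; rewrite -lee_fin; apply: le_trans (le1 b Kb).
  by apply: integral_ge0 => a _; rewrite lee_fin; have /andP[] := F0M a b.
have pf := continuous_payoff cf f0.
exists v, mu1, mu2; split => //; split => // nu PUnu.
- apply: ext_le => // b Kb; apply: le_trans (le1 b Kb).
  by rewrite le_eqVlt; apply/orP; left; apply/eqP;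
     apply: eq_integral => a /set_mem Ka; rewrite Ff.
- apply: ext_ge => // a Ka; apply: le_trans (ge2 a Ka) _.
  by rewrite le_eqVlt; apply/orP; left; apply/eqP;
     apply: eq_integral => b /set_mem Kb; rewrite Ff.
Qed.

Lemma value_le f f' v v' mu1 mu2 mu1' mu2' (k : R) : 0 <= k ->
  payoff K1 K2 f -> payoff K1 K2 f' ->
  (forall a b, K1 a -> K2 b -> f a b <= f' a b + k) ->
  is_value f v mu1 mu2 -> is_value f' v' mu1' mu2' -> v <= v' + k.
Proof.
move=> k0 pf pf' ff' [P1 P2 _ ge] [P1' P2' le _].
rewrite -lee_fin; apply: le_trans (ge _ P1') _.
apply: (@le_trans _ _ (ext K1 K2 (fun a b => f' a b + k) mu1' mu2)).
  by apply: le_ext => //; apply: payoffD => //; exact: payoff_cst.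
rewrite extD//; last exact: payoff_cst.
by rewrite ext_cst// EFinD leeD2r// le.
Qed.

End Value.

(** * One-stage games of the Markov game and time to absorption *)

Section Stage.
Variables (R : realType) (S : finType) (G : game R S).
Hypothesis hG : is_game G.
Hypothesis hp : forall x y : S,
  {within U1 G `*` U2 G, continuous (fun r : R * R => p G x y r.1 r.2)}.
Hypothesis hc : forall x : S,
  {within U1 G `*` U2 G, continuous (fun r : R * R => c G x r.1 r.2)}.
Implicit Types (u V : S -> R) (x y : S).
Local Notation K1 := (U1 G).
Local Notation K2 := (U2 G).
Local Notation T := (measurableTypeR R).

Definition average u x (a b : R) := \sum_y u y * p G x y a b.
Definition stage V x (a b : R) := c G x a b + average V x a b.

Lemma compact_U1 : compact K1. Proof. by case: hG => -[]. Qed.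
Lemma compact_U2 : compact K2. Proof. by case: hG => _ []. Qed.
Lemma U1_neq0 : K1 !=set0. Proof. by case: hG => -[]. Qed.
Lemma U2_neq0 : K2 !=set0. Proof. by case: hG => _ []. Qed.
Lemma measurable_U1 : measurable (K1 : set T).
Proof. exact: compact_measurable compact_U1. Qed.
Lemma measurable_U2 : measurable (K2 : set T).
Proof. exact: compact_measurable compact_U2. Qed.

Lemma p_ge0 x y a b : K1 a -> K2 b -> 0 <= p G x y a b.
Proof. by move=> Ka Kb; case: hG => _ _ /(_ a b Ka Kb)[+ _] _ _; exact. Qed.
Lemma p_sum1 x a b : K1 a -> K2 b -> \sum_y p G x y a b = 1.
Proof. by move=> Ka Kb; case: hG => _ _ /(_ a b Ka Kb)[_ +] _ _; exact. Qed.
Lemma c_ge0 x a b : K1 a -> K2 b -> 0 <= c G x a b.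
Proof. by move=> Ka Kb; case: hG => _ _ _ _ [+ _]; exact. Qed.
Lemma g_ge0 x : 0 <= g G x.
Proof. by case: hG => _ _ _ _ []. Qed.

Lemma payoff_p x y : payoff K1 K2 (p G x y).
Proof.
apply: (continuous_payoff compact_U1 U1_neq0 compact_U2 U2_neq0) => //.
by move=> a b; exact: p_ge0.
Qed.

Lemma payoff_c x : payoff K1 K2 (c G x).
Proof.
apply: (continuous_payoff compact_U1 U1_neq0 compact_U2 U2_neq0) => //.
by move=> a b; exact: c_ge0.
Qed.

Lemma payoff_average u x : (forall y, 0 <= u y) -> payoff K1 K2 (average u x).
Proof.
move=> u0; apply: (payoff_sum measurable_U1 measurable_U2) => y.
by apply: payoffZ => //; exact: payoff_p.
Qed.

Lemma payoff_stage V x : (forall y, 0 <= V y) -> payoff K1 K2 (stage V x).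
Proof.
by move=> V0; apply: payoffD; [exact: payoff_c|exact: payoff_average].
Qed.

Lemma ext_stage V x mu nu : (forall y, 0 <= V y) ->
  ext K1 K2 (stage V x) mu nu =
  (ext K1 K2 (c G x) mu nu + ext K1 K2 (average V x) mu nu)%E.
Proof.
by move=> V0; rewrite extD//; [exact: payoff_c|exact: payoff_average].
Qed.

Lemma ext_average u x mu nu : PU K1 mu -> PU K2 nu -> (forall y, 0 <= u y) ->
  ext K1 K2 (average u x) mu nu =
  (\sum_y (u y)%:E * ext K1 K2 (p G x y) mu nu)%E.
Proof.
move=> PU1 PU2 u0; rewrite (ext_sum measurable_U1 measurable_U2)//.
- by apply: eq_bigr => y _; rewrite extZ//; exact: payoff_p.
- by move=> y; apply: payoffZ => //; exact: payoff_p.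
Qed.

Lemma continuous_average u x : continuous_on K1 K2 (average u x).
Proof.
rewrite /continuous_on /average => z.
elim: (index_enum S) => [|y s IH].
  rewrite (_ : (fun r => _) = cst 0); first exact: cst_continuous.
  by apply/funext => r; rewrite big_nil.
rewrite (_ : (fun r => _) = (fun r : R * R => u y * p G x y r.1 r.2 +
    \sum_(y <- s) u y * p G x y r.1 r.2)); last first.
  by apply/funext => r; rewrite big_cons.
apply: continuousD IH; apply: continuousM; first exact: cst_continuous.
exact: hp.
Qed.

Lemma continuous_stage V x : continuous_on K1 K2 (stage V x).
Proof.
rewrite /continuous_on /stage => z.
exact: (continuousD (@hc x z) (@continuous_average V x z)).
Qed.

Lemma average_ge0 u x a b : K1 a -> K2 b -> (forall y, 0 <= u y) ->
  0 <= average u x a b.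
Proof.
by move=> Ka Kb u0; rewrite sumr_ge0// => y _; rewrite mulr_ge0// p_ge0.
Qed.

Lemma stage_ge0 V x a b : (forall y, 0 <= V y) -> K1 a -> K2 b ->
  0 <= stage V x a b.
Proof. by move=> V0 Ka Kb; rewrite addr_ge0 ?c_ge0// average_ge0. Qed.

Lemma le_average u u' x a b : K1 a -> K2 b -> (forall y, u y <= u' y) ->
  average u x a b <= average u' x a b.
Proof.
by move=> Ka Kb uu'; apply: ler_sum => y _; rewrite ler_wpM2r// p_ge0.
Qed.

Lemma averageDr u (k : R) x a b : K1 a -> K2 b ->
  average (fun y => u y + k) x a b = average u x a b + k.
Proof.
move=> Ka Kb; rewrite /average; under eq_bigr do rewrite mulrDl.
by rewrite big_split/= -mulr_sumr p_sum1// mulr1.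
Qed.

Lemma average_absorbing u x a b : x \in absorbing G -> K1 a -> K2 b ->
  average u x a b = u x.
Proof.
move=> xA Ka Kb; case: hG => _ _ _ /(_ x a b xA Ka Kb) px1 _.
rewrite /average (bigD1 x)//= px1 mulr1 big1 ?addr0// => y yx.
have := p_sum1 x Ka Kb; rewrite (bigD1 x)//= px1 => sum1.
have sum0 : \sum_(z | z != x) p G x z a b = 0 by lra.
by rewrite (psumr_eq0P _ sum0) ?mulr0// => z _; exact: p_ge0.
Qed.

(** A continuous function on a compact set attains its maximum; the choice is
made for all [u] at once in order to iterate it. *)
Lemma average_maximizer : exists sel : (S -> R) -> S -> R * R,
  forall u x, [/\ K1 (sel u x).1, K2 (sel u x).2 & forall a b, K1 a -> K2 b ->
    average u x a b <= average u x (sel u x).1 (sel u x).2].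
Proof.
have cK := compact_setX compact_U1 compact_U2.
have K0 : K1 `*` K2 !=set0.
  by have [a Ka] := U1_neq0; have [b Kb] := U2_neq0; exists (a, b).
have H (i : (S -> R) * S) : exists r : R * R, [/\ K1 r.1, K2 r.2 &
    forall a b, K1 a -> K2 b -> average i.1 i.2 a b <= average i.1 i.2 r.1 r.2].
  have [r /set_mem[r1 r2] rmax] :=
    compact_EVT_max K0 cK (@continuous_average i.1 i.2).
  by exists r; split => // a b Ka Kb; apply: (rmax (a, b)); rewrite inE.
have [sel selP] := choice H.
by exists (fun u x => sel (u, x)) => u x; exact: (selP (u, x)).
Qed.

Definition alive x : R := (x \notin absorbing G)%:R.

(** [u k x] is the probability of being alive after [k] steps from [x], when the
pure actions [r j y] are played at [y] with [j + 1] steps to go. *)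
Definition exit_bound (n : nat) (gamma : R) :=
  forall (r : nat -> S -> R * R) (u : nat -> S -> R),
  (forall k x, K1 (r k x).1 /\ K2 (r k x).2) ->
  u 0 = alive -> (forall k x, u k.+1 x = average (u k) x (r k x).1 (r k x).2) ->
  forall x, u n x <= 1 - gamma.

(** Let [u k] be the largest probability of being alive after [k] steps, which
backward induction attains by pure Markov actions; then [u n] is at most
[(1 - gamma) * alive].  Let [h] be the sum of the [u k] for [k < n], divided by
[gamma].  Its expected value after one step is at most [h + (u n - u 0) / gamma],
hence at most [h - alive].  As [h <= (n / gamma) * alive], this is at most
[beta * h] for some [beta < 1]. *)
Lemma exit_potential (n : nat) (gamma : R) : 0 < gamma -> exit_bound n gamma ->
  exists h : S -> R, exists beta : R,
  [/\ 0 <= beta < 1, forall x, 0 <= h x,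
     forall x a b, K1 a -> K2 b -> alive x + average h x a b <= h x &
     forall x a b, K1 a -> K2 b -> average h x a b <= beta * h x].
Proof.
move=> gamma0 hexit; have [sel selP] := average_maximizer.
pose L u x := average u x (sel u x).1 (sel u x).2.
pose u k := iter k L alive.
have L0 v x : (forall y, 0 <= v y) -> 0 <= L v x.
  by move=> v0; have [? ? _] := selP v x; exact: average_ge0.
have alive0 x : 0 <= alive x by rewrite /alive ler0n.
have u0 k x : 0 <= u k x by elim: k x => //= k IH x; exact: L0.
have ule k x : u k x <= alive x.
  elim: k x => //= k IH x; have [Ka Kb _] := selP (u k) x.
  have [xA|xA] := boolP (x \in absorbing G).
    by rewrite /L average_absorbing.
  rewrite /alive xA /L -(p_sum1 x Ka Kb); apply: ler_sum => y _.
  rewrite ler_piMl ?p_ge0//; apply: le_trans (IH y) _.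
  by rewrite /alive lern1 leq_b1.
have un x : u n x <= (1 - gamma) * alive x.
  have := ule n x; rewrite /alive; case: (x \notin absorbing G) => /=.
    move=> _; rewrite mulr1.
    apply: (hexit (fun k => sel (u k)) u) => //.
    by move=> k z; have [] := selP (u k) z.
  by rewrite mulr0.
pose h x := gamma^-1 * \sum_(0 <= k < n) u k x.
have h0 x : 0 <= h x by rewrite mulr_ge0 ?invr_ge0 ?(ltW gamma0)// sumr_ge0.
have hav x a b : K1 a -> K2 b -> alive x + average h x a b <= h x.
  move=> Ka Kb.
  have -> : average h x a b = gamma^-1 * \sum_(0 <= k < n) average (u k) x a b.
    rewrite /average exchange_big/= mulr_sumr; apply: eq_bigr => y _.
    by rewrite -mulrA mulr_suml.
  have -> : alive x = gamma^-1 * (gamma * alive x) by rewrite mulKf ?gt_eqF.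
  rewrite -mulrDr ler_wpM2l ?invr_ge0 ?(ltW gamma0)//.
  have : \sum_(0 <= k < n) average (u k) x a b <= \sum_(0 <= k < n) u k.+1 x.
    by apply: ler_sum => k _; have [_ _] := selP (u k) x; exact.
  have := telescope_sumr (fun k => u k x) (leq0n n); rewrite sumrB.
  by have := un x; rewrite [u 0 x]/= => ? ? ?; lra.
have hle x : h x <= (n%:R / gamma) * alive x.
  rewrite mulrAC mulrC ler_wpM2l ?invr_ge0 ?(ltW gamma0)//.
  rewrite mulr_natl -[X in _ *+ X](subn0 n) -sumr_const_nat.
  by apply: ler_sum => k _.
(* The successor keeps the denominator positive, the maximum makes [beta >= 0]. *)
pose beta := Num.max 0 (1 - gamma / n.+1%:R).
exists h, beta; split => //.
- rewrite /beta le_max lexx/= gt_max ltr01/= ltrBlDr ltrDl.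
  by rewrite divr_gt0// ltr0n.
move=> x a b Ka Kb; apply: (@le_trans _ _ ((1 - gamma / n.+1%:R) * h x)); last first.
  by rewrite ler_wpM2r// /beta le_max lexx orbT.
have := hav x a b Ka Kb.
suff : gamma / n.+1%:R * h x <= alive x.
  rewrite [(1 - _) * _]mulrBl mul1r; move: (gamma / n.+1%:R * h x) => z.
  by lra.
apply: (@le_trans _ _ (gamma / n.+1%:R * (n%:R / gamma * alive x))).
  by rewrite ler_wpM2l// divr_ge0// ltW.
have -> : gamma / n.+1%:R * (n%:R / gamma * alive x) =
    n%:R / n.+1%:R * alive x.
  have := lt0r_neq0 gamma0; have : n.+1%:R != 0 :> R by rewrite pnatr_eq0.
  by move: (n.+1%:R : R) => N N0 g0; field; rewrite N0 g0.
by rewrite ler_piMl// ler_pdivrMr ?ltr0n// mul1r ler_nat.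
Qed.

End Stage.

(** * The Shapley operator and its fixed point *)

Section Shapley.
Variables (R : realType) (S : finType) (G : game R S).
Hypothesis hG : is_game G.
Hypothesis hp : forall x y : S,
  {within U1 G `*` U2 G, continuous (fun r : R * R => p G x y r.1 r.2)}.
Hypothesis hc : forall x : S,
  {within U1 G `*` U2 G, continuous (fun r : R * R => c G x r.1 r.2)}.
Implicit Types (u V : S -> R) (x y : S).
Local Notation K1 := (U1 G).
Local Notation K2 := (U2 G).

(** Chosen among the values of the one-stage game; [value_le] makes the result
monotone in [V] whatever the choice. *)
Definition stage_value V x : R := xget 0 [set v | 0 <= v /\
  exists mu1 mu2, is_value K1 K2 (stage G V x) v mu1 mu2].

Definition shapley V x : R :=
  if x \in absorbing G then g G x else stage_value V x.

Lemma stage_valueP V x : (forall y, 0 <= V y) -> 0 <= stage_value V x /\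
  exists mu1 mu2, is_value K1 K2 (stage G V x) (stage_value V x) mu1 mu2.
Proof.
move=> V0; have [v [mu1 [mu2 [v0 vP]]]] := @value_exists R K1 K2
  (compact_U1 hG) (U1_neq0 hG) (compact_U2 hG) (U2_neq0 hG) (stage G V x)
  (@continuous_stage R S G hp hc V x) (fun a b => stage_ge0 hG x V0).
apply: (@xgetPex R 0 [set v | 0 <= v /\ exists mu1 mu2,
  is_value K1 K2 (stage G V x) v mu1 mu2]).
by exists v; split => //; exists mu1, mu2.
Qed.

Lemma shapley_ge0 V x : (forall y, 0 <= V y) -> 0 <= shapley V x.
Proof.
move=> V0; rewrite /shapley; case: ifP => _; first exact: g_ge0.
by have [] := stage_valueP x V0.
Qed.

(** Monotonicity and nonexpansiveness at once: [k = 0] gives the former. *)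
Lemma shapley_le V V' (k : R) x : (forall y, 0 <= V y) -> (forall y, 0 <= V' y) ->
  0 <= k -> (forall y, V y <= V' y + k) -> shapley V x <= shapley V' x + k.
Proof.
move=> V0 V'0 k0 VV'; rewrite /shapley; case: (x \in absorbing G); first by rewrite -[leLHS]addr0 lerD2l.
have [_ [mu1 [mu2 vP]]] := stage_valueP x V0.
have [_ [mu1' [mu2' vP']]] := stage_valueP x V'0.
apply: value_le k0 _ _ _ vP vP'.
- exact: compact_U1 hG.
- exact: compact_U2 hG.
- exact: payoff_stage.
- exact: payoff_stage.
- move=> a b Ka Kb; rewrite /stage -addrA lerD2l -(averageDr hG)//.
  exact: le_average.
Qed.

Lemma shapley_mono V V' x : (forall y, 0 <= V y) -> (forall y, 0 <= V' y) ->
  (forall y, V y <= V' y) -> shapley V x <= shapley V' x.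
Proof.
move=> V0 V'0 VV'; rewrite -[leRHS]addr0; apply: (shapley_le x V0 V'0 (lexx 0)).
by move=> y; rewrite addr0.
Qed.

Lemma cost_bound : exists2 C : R, 0 <= C &
  forall x a b, K1 a -> K2 b -> c G x a b <= C.
Proof.
have cK := compact_setX (compact_U1 hG) (compact_U2 hG).
have K0 : K1 `*` K2 !=set0.
  have [a Ka] := U1_neq0 hG; have [b Kb] := U2_neq0 hG.
  by exists (a, b).
have H x : exists C, 0 <= C /\ forall a b, K1 a -> K2 b -> c G x a b <= C.
  have [r /set_mem[r1 r2] rmax] := compact_EVT_max K0 cK (@hc x).
  exists (c G x r.1 r.2); split; first exact: (c_ge0 hG).
  by move=> a b Ka Kb; apply: (rmax (a, b)); rewrite inE.
have [C CP] := choice H.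
have C0 x : 0 <= C x by have [] := CP x.
exists (\sum_x C x); first by rewrite sumr_ge0.
move=> x a b Ka Kb; have [_ /(_ a b Ka Kb)/le_trans] := CP x; apply.
by rewrite (bigD1 x)//= lerDl sumr_ge0.
Qed.

(** Value iteration from [0] increases, and [C * h + sum g] is a supersolution
bounding it.  The limit is a fixed point because the convergence is uniform on the
finite set [S] and the operator is nonexpansive. *)
Lemma shapley_fixpoint (h : S -> R) : (forall x, 0 <= h x) ->
  (forall x a b, K1 a -> K2 b -> alive G x + average G h x a b <= h x) ->
  exists2 V : S -> R, forall x, 0 <= V x & forall x, V x = shapley V x.
Proof.
move=> h0 hP; have [C C0 cC] := cost_bound.
pose gm := \sum_x g G x.
have ggm x : g G x <= gm.
  by rewrite /gm (bigD1 x)//= lerDl sumr_ge0// => y _; exact: (g_ge0 hG).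
have gm0 : 0 <= gm by rewrite sumr_ge0// => y _; exact: (g_ge0 hG).
pose W x := C * h x + gm.
have W0 x : 0 <= W x by rewrite addr_ge0// mulr_ge0.
have shW x : shapley W x <= W x.
  rewrite /shapley; case: ifPn => xA.
    by rewrite /W (le_trans (ggm x))// lerDr mulr_ge0.
  have [_ [mu1 [mu2 [P1 P2 _ vle]]]] := stage_valueP x W0.
  rewrite -lee_fin; apply: le_trans (vle _ P1) _.
  rewrite -(@ext_cst R K1 K2 (measurable_U1 hG) (measurable_U2 hG) (W x) mu1 mu2 P1 P2).
  have pW : payoff K1 K2 (fun _ _ => W x).
    by apply: payoff_cst; [exact: measurable_U1|exact: measurable_U2|].
  apply: le_ext => //; first exact: payoff_stage.
  move=> a b Ka Kb; rewrite /stage (averageDr hG)//.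
  have -> : average G (fun y => C * h y) x a b = C * average G h x a b.
    by rewrite /average mulr_sumr; apply: eq_bigr => y _; rewrite mulrA.
  rewrite /W addrA lerD2r.
  apply: (@le_trans _ _ (C * (alive G x + average G h x a b))).
    by rewrite mulrDr /alive xA mulr1 lerD2r cC.
  by rewrite ler_wpM2l// hP.
pose v k := iter k shapley (fun=> 0).
have v0 k x : 0 <= v k x by elim: k x => [x|k IH x]; [exact: lexx|exact: (shapley_ge0 x IH)].
have vW k x : v k x <= W x.
  elim: k x => [|k IH] x; first exact: W0.
  exact: (le_trans (shapley_mono x (v0 k) W0 IH) (shW x)).
have vS k x : v k x <= v k.+1 x.
  elim: k x => [|k IH] x; first exact: (v0 1).
  exact: (shapley_mono x (v0 k) (v0 k.+1) IH).
have vmono x : {homo (fun k => v k x) : k l / (k <= l)%N >-> k <= l}.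
  by apply: homo_leq => [y|y z t|k]; [exact: lexx|exact: le_trans|exact: vS].
pose V x := sup (range (fun k => v k x)).
have ub x : has_sup (range (fun k => v k x)).
  split; first by exists (v 0 x), 0.
  by exists (W x) => _ [k _ <-].
have vV k x : v k x <= V x by apply: ub_le_sup (ub x).2 _ _; exists k.
have V0 x : 0 <= V x by exact: (le_trans (v0 0 x) (vV 0 x)).
exists V; first exact: V0.
move=> x; apply/eqP; rewrite eq_le; apply/andP; split.
- apply: sup_le_ub; first by exists (v 0 x), 0.
  move=> _ [k _ <-]; apply: (le_trans (vS k x)).
  exact: (shapley_mono x (v0 k) V0 (vV k)).
- apply/ler_addgt0Pr => e e0.
  have H y : exists k, V y <= v k y + e.
    have [_ [k _ <-] ke] := sup_adherent e0 (ub y).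
    by exists k; rewrite -lerBlDr ltW.
  have [k kP] := choice H.
  (* One iterate is within [e] of the limit at all states. *)
pose N := \max_y k y.
  have VN y : V y <= v N y + e.
    apply: le_trans (kP y) _; rewrite lerD2r vmono//.
    by rewrite /N (bigD1 y)//= leq_maxl.
  apply: (@le_trans _ _ (v N.+1 x + e)); last first.
    by rewrite lerD2r; exact: (vV N.+1 x).
  exact: (shapley_le x V0 (v0 N) (ltW e0) VN).
Qed.

End Shapley.

(** * Costs along an admissible chain *)

Section Chain.
Variables (R : realType) (S : finType) (G : game R S).
Hypothesis hG : is_game G.
Hypothesis hp : forall x y : S,
  {within U1 G `*` U2 G, continuous (fun r : R * R => p G x y r.1 r.2)}.
Hypothesis hc : forall x : S,
  {within U1 G `*` U2 G, continuous (fun r : R * R => c G x r.1 r.2)}.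
Variables (x : S) (C : controlled_chain R S).
Hypothesis admC : admissible G x C.
Implicit Types (u V : S -> R) (y : S).
Local Notation K1 := (U1 G).
Local Notation K2 := (U2 G).
Local Notation Om := (Omega C).
Local Notation P := (Pr C).
Local Notation X := (xi C).
Local Open Scope ereal_scope.

Lemma measurable_xi k y : measurable (X k @^-1` [set y]).
Proof. by case: admC. Qed.

Lemma measurable_xi_fun d (T : measurableType d) k (F : S -> Om -> T) :
  (forall y, measurable_fun [set: Om] (F y)) ->
  measurable_fun [set: Om] (fun w => F (X k w) w).
Proof.
move=> mF _ A mA; rewrite setTI.
rewrite (_ : _ @^-1` A = \bigcup_y (X k @^-1` [set y] `&` F y @^-1` A)).
  apply: countable_bigcupT_measurable; first exact: countableP.
  move=> y; apply: measurableI; first exact: measurable_xi.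
  by rewrite -[_ @^-1` _]setTI; exact: mF.
apply/seteqP; split => [w Aw|w [y _ [/= <-]]//].
by exists (X k w).
Qed.

(** The generators in the definition of [history], named in order to use [history]
as the measurable sets of a measurable type. *)
Definition gen (n : nat) : set (set Om) :=
  \bigcup_(k in [set k | (k <= n)%N])
        (range (fun y : S => X k @^-1` [set y]) `|`
         preimage_set_system setT (m1 C k) measurable `|`
         preimage_set_system setT (m2 C k) measurable).

Lemma history_measurable n A : history C n A -> measurable A.
Proof.
move: A; apply: smallest_sub; first exact: sigma_algebra_measurable.
move=> A [k _ [[[y _ <-]|[B mB <-]]|[B mB <-]]].
- exact: measurable_xi.
- by case: admC => _ /(_ k)[+ _] _ _ _; exact.
- by case: admC => _ /(_ k)[_ +] _ _ _; exact.
Qed.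

Lemma history_setT n : history C n setT.
Proof. exact: (@measurableT _ (g_sigma_algebraType (gen n))). Qed.

Lemma history_xi n k (Q : set S) : (k <= n)%N -> history C n (X k @^-1` Q).
Proof.
move=> kn.
rewrite (_ : _ @^-1` Q = \bigcup_y (X k @^-1` ([set y] `&` Q))); last first.
  by apply/seteqP; split => [w Qw|w [y _ []]//]; exists (X k w).
apply: (@countable_bigcupT_measurable _ (g_sigma_algebraType (gen n))).
  exact: countableP.
move=> y; have [Qy|nQy] := pselect (Q y).
  rewrite (_ : [set y] `&` Q = [set y]); last first.
    by apply/seteqP; split => [z []//|z ->].
  by apply: sub_sigma_algebra; exists k => //; left; left; exists y.
rewrite (_ : [set y] `&` Q = set0); last first.
  by apply/seteqP; split => [z [-> ]//|z].
by rewrite preimage_set0; exact: (@measurable0 _ (g_sigma_algebraType (gen n))).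
Qed.

Definition alive_before k : set Om :=
  [set w | forall j, (j < k)%N -> X j w \notin absorbing G].

Local Notation D := alive_before.

Definition absorbed_at k : set Om :=
  D k `&` [set w | X k w \in absorbing G].

Lemma alive_beforeS k : D k.+1 = D k `&` [set w | X k w \notin absorbing G].
Proof.
apply/seteqP; split => [w Dw|w [Dw nA] j].
  by split; [move=> j jk; exact/Dw/ltnW|exact: Dw].
by rewrite ltnS leq_eqVlt => /predU1P[->//|]; exact: Dw.
Qed.

Lemma history_alive k : history C k (D k.+1).
Proof.
suff H n j : (j <= n)%N -> history C n (D j.+1) by exact: H.
elim: j => [_|j IH jn].
  rewrite alive_beforeS (_ : D 0 = setT); last by apply/seteqP; split.
  by rewrite setTI; exact: (history_xi [set y | y \notin absorbing G]).
rewrite alive_beforeS.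
exact: (@measurableI _ (g_sigma_algebraType (gen n)) _ _ (IH (ltnW jn))
  (history_xi [set y | y \notin absorbing G] jn)).
Qed.

Lemma measurable_alive k : measurable (D k).
Proof.
case: k => [|k]; last exact: history_measurable (@history_alive k).
by rewrite (_ : D 0 = setT)//; apply/seteqP; split.
Qed.

Lemma measurable_absorbed k : measurable (absorbed_at k).
Proof.
apply: measurableI; first exact: measurable_alive.
apply: (@history_measurable k).
exact: (@history_xi k k [set y | y \in absorbing G] (leqnn k)).
Qed.

Definition ext_at (f : S -> R -> R -> R) k w : \bar R :=
  ext K1 K2 (f (X k w)) (m1 C k w) (m2 C k w).

Lemma PU_at k w : PU K1 (m1 C k w) /\ PU K2 (m2 C k w).
Proof. by case: admC. Qed.

Lemma measurable_ext_at f k : (forall y, payoff K1 K2 (f y)) ->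
  measurable_fun [set: Om] (ext_at f k).
Proof.
move=> pf; apply: (@measurable_xi_fun _ _ k
  (fun y w => ext K1 K2 (f y) (m1 C k w) (m2 C k w))).
move=> y; case: admC => _ /(_ k)[mm1 mm2] _ _ _.
exact: measurable_ext.
Qed.

Lemma measurable_at u k : measurable_fun [set: Om] (fun w => (u (X k w))%:E).
Proof.
by apply: (@measurable_xi_fun _ _ k (fun y _ => (u y)%:E)) => y; exact: measurable_cst.
Qed.

Lemma ext_at_ge0 f k w : (forall y, payoff K1 K2 (f y)) -> 0 <= ext_at f k w.
Proof. by move=> pf; exact: ext_ge0. Qed.

(** The defining property of admissibility, integrated against [u]. *)
Lemma one_step u k A : (forall y, (0 <= u y)%R) -> history C k A ->
  \int[P]_(w in A) (u (X k.+1 w))%:E =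
  \int[P]_(w in A) ext_at (average G u) k w.
Proof.
move=> u0 hA; have mA := history_measurable hA.
transitivity (\sum_y (u y)%:E * P (A `&` X k.+1 @^-1` [set y])).
  rewrite (eq_integral (fun w => \sum_y (u y)%:E * (\1_(X k.+1 @^-1` [set y]) w)%:E)); last first.
    move=> w _; rewrite (bigD1 (X k.+1 w))//= big1 => [|y yX].
      by rewrite indicE mem_set// mule1 adde0.
    by rewrite indicE memNset ?mule0//= => yX'; rewrite yX' eqxx in yX.
  rewrite ge0_integral_sum//; first last.
  - by move=> y w _; rewrite mule_ge0 ?lee_fin.
  - move=> y; apply: measurable_funeM; apply/measurable_EFinP.
    by apply: measurable_funTS; apply: measurable_indic; exact: measurable_xi.
  apply: eq_bigr => y _; rewrite ge0_integralZl//; first last.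
  - by rewrite lee_fin.
  - apply/measurable_EFinP.
    by apply: measurable_funTS; apply: measurable_indic; exact: measurable_xi.
  by rewrite integral_indic//; [rewrite setIC|exact: measurable_xi].
rewrite (eq_integral (fun w => \sum_y (u y)%:E * ext_at (p G ^~ y) k w)); last first.
  by move=> w _; have [? ?] := PU_at k w; rewrite /ext_at ext_average.
have pp y z : payoff K1 K2 (p G z y) by exact: payoff_p.
rewrite ge0_integral_sum//; first last.
- by move=> y w _; rewrite mule_ge0 ?lee_fin//; exact: (ext_at_ge0 k w (pp y)).
- move=> y; apply: measurable_funeM; apply: measurable_funTS.
  exact: (measurable_ext_at k (pp y)).
apply: eq_bigr => y _; rewrite ge0_integralZl//; first last.
- by rewrite lee_fin.
- by move=> w _; exact: (ext_at_ge0 k w (pp y)).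
- by apply: measurable_funTS; exact: (measurable_ext_at k (pp y)).
by congr (_ * _); case: admC => _ _ _ _ /(_ k y A hA).
Qed.

Lemma integral_xi0 u : (forall y, (0 <= u y)%R) ->
  \int[P]_w (u (X 0 w))%:E = (u x)%:E.
Proof.
move=> u0; case: admC => _ _ _ Px _.
have mx := measurable_xi 0 x.
rewrite -(setUv (X 0 @^-1` [set x])) ge0_integral_setU//; first last.
- exact/disj_setPCl.
- by move=> w _; rewrite lee_fin.
- by rewrite setUv; exact: measurable_at.
- exact: measurableC.
rewrite [X in _ + X]null_set_integral ?adde0; first last.
- apply: (etrans (probability_setC P mx)).
  by rewrite [X in 1 - X]Px subee.
- by apply: measurable_funTS; exact: measurable_at.
- exact: measurableC.
rewrite (eq_integral (cst (u x)%:E)); last by move=> w /set_mem /= ->.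
by rewrite integral_cst// [X in _ * X]Px mule1.
Qed.


Definition running := ext_at (c G).

(** The contribution of time [k] to the total cost: the running cost if the chain
is still alive after looking at [xi k], the terminal cost if it is absorbed at
time [k], and [0] afterwards.  The total cost is the series of these functions,
whether or not the chain is ever absorbed. *)
Definition stage_cost k : Om -> \bar R :=
  (running k \_ (D k.+1)) \+ ((fun w => (g G (X k w))%:E) \_ (absorbed_at k)).

Lemma running_ge0 k w : 0 <= running k w.
Proof. by apply: ext_at_ge0 => y; exact: payoff_c. Qed.

Lemma stage_cost_ge0 k w : 0 <= stage_cost k w.
Proof.
apply: adde_ge0; rewrite patchE; case: ifP => // _; first exact: running_ge0.
by rewrite lee_fin; exact: (g_ge0 hG).
Qed.

Lemma stage_cost_alive k w : D k.+1 w -> stage_cost k w = running k w.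
Proof.
move=> Dw; rewrite /stage_cost !patchE mem_set// memNset ?adde0//.
by move=> [_ /=]; apply/negP; exact: Dw.
Qed.

Lemma stage_cost_absorbed k w : absorbed_at k w ->
  stage_cost k w = (g G (X k w))%:E.
Proof.
move=> Aw; rewrite /stage_cost !patchE memNset ?add0e ?mem_set//.
by move=> Dw; case: Aw => _ /=; apply/negP; exact: Dw.
Qed.

Lemma stage_cost_dead k w : ~ D k w -> stage_cost k w = 0.
Proof.
move=> nD; rewrite /stage_cost !patchE !memNset ?adde0//; first by case.
by rewrite alive_beforeS => -[].
Qed.

Lemma total_cost_series w :
  total_cost G w = \sum_(0 <= k <oo) stage_cost k w.
Proof.
rewrite /total_cost /exit_time; case: pselect => [ex|nex]; last first.
  apply: eq_eseriesr => k _; rewrite stage_cost_alive// => j _.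
  by apply/negP => Xj; apply: nex; exists j.
case: ex_minnP => N XN minN.
have DN : D N w.
  by move=> j jN; apply/negP => /minN; rewrite leqNgt jN.
rewrite (@nneseries_split _ _ 0 N.+1); last by move=> k _; exact: stage_cost_ge0.
rewrite [X in _ = _ + X]eseries0 ?adde0; last first.
  move=> k; rewrite add0n => Nk _; apply: stage_cost_dead => /(_ N Nk).
  by rewrite XN.
rewrite add0n big_nat_recr//= stage_cost_absorbed//; congr (_ + _).
apply: eq_big_nat => k /andP[_ kN]; rewrite stage_cost_alive// => j jk.
by apply: DN; exact: leq_trans kN.
Qed.

Lemma measurable_running k : measurable_fun [set: Om] (running k).
Proof. by apply: measurable_ext_at => y; exact: payoff_c. Qed.

Lemma measurable_stage_cost k : measurable_fun [set: Om] (stage_cost k).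
Proof.
apply: emeasurable_funD; apply/(measurable_restrictT _ _).1.
- exact: measurable_alive.
- by apply: measurable_funTS; exact: measurable_running.
- exact: measurable_absorbed.
- by apply: measurable_funTS; exact: measurable_at.
Qed.

Lemma expected_cost_series :
  expected_cost G C = \sum_(0 <= k <oo) \int[P]_w stage_cost k w.
Proof.
rewrite /expected_cost -integral_nneseries//.
- by apply: eq_integral => w _; exact: total_cost_series.
- by move=> k; exact: measurable_stage_cost.
- by move=> k w _; exact: stage_cost_ge0.
Qed.

Lemma integral_stage_cost k : \int[P]_w stage_cost k w =
  \int[P]_(w in D k.+1) running k w +
  \int[P]_(w in absorbed_at k) (g G (X k w))%:E.
Proof.
rewrite ge0_integralD//.
- by rewrite -!integral_mkcond.
- by move=> w _; rewrite patchE; case: ifP => // _; exact: running_ge0.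
- apply/(measurable_restrictT _ _).1; first exact: measurable_alive.
  by apply: measurable_funTS; exact: measurable_running.
- move=> w _; rewrite patchE; case: ifP => // _.
  by rewrite lee_fin; exact: (g_ge0 hG).
- apply/(measurable_restrictT _ _).1; first exact: measurable_absorbed.
  by apply: measurable_funTS; exact: measurable_at.
Qed.

Section Verification.
Variable V : S -> R.
Hypothesis V0 : forall y, (0 <= V y)%R.
Hypothesis Vg : forall y, y \in absorbing G -> V y = g G y.

Lemma alive_split k : \int[P]_(w in D k) (V (X k w))%:E =
  \int[P]_(w in absorbed_at k) (g G (X k w))%:E +
  \int[P]_(w in D k.+1) (V (X k w))%:E.
Proof.
have -> : D k = absorbed_at k `|` D k.+1.
  rewrite alive_beforeS -setIUr (_ : _ `|` _ = setT) ?setIT//.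
  by apply/seteqP; split => // w _ /=; case: (X k w \in absorbing G); [left|right].
rewrite ge0_integral_setU//.
- congr (_ + _); apply: eq_integral => w /set_mem[_ /= XA].
  by rewrite Vg.
- exact: measurable_absorbed.
- exact: measurable_alive.
- by apply: measurable_funTS; exact: measurable_at.
- by move=> w _; rewrite lee_fin.
- apply/disj_setPS => w [[_ /= XA] Dw]; have := Dw k (ltnSn k).
  by rewrite XA.
Qed.

Lemma cost_to_go k : \int[P]_w stage_cost k w +
    \int[P]_(w in D k.+1) (V (X k.+1 w))%:E =
  \int[P]_(w in absorbed_at k) (g G (X k w))%:E +
  \int[P]_(w in D k.+1) ext_at (stage G V) k w.
Proof.
rewrite integral_stage_cost [X in X + _]addeC -addeA; congr (_ + _).
have pV y : payoff K1 K2 (average G V y) by exact: payoff_average.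
rewrite (one_step V0 (@history_alive k)) -ge0_integralD//.
- by apply: eq_integral => w _; rewrite /running /ext_at ext_stage.
- exact: measurable_alive.
- by move=> w _; exact: running_ge0.
- by apply: measurable_funTS; exact: measurable_running.
- by move=> w _; exact: (ext_at_ge0 k w pV).
- by apply: measurable_funTS; exact: (measurable_ext_at k pV).
Qed.

Lemma measurable_stage k : measurable_fun [set: Om] (ext_at (stage G V) k).
Proof. by apply: measurable_ext_at => y; exact: payoff_stage. Qed.

Lemma stage_at_ge0 k w : 0 <= ext_at (stage G V) k w.
Proof. by apply: ext_at_ge0 => y; exact: payoff_stage. Qed.

(** Dropping the nonnegative remainder, the partial sums of the expected stage
costs are at most [V x]. *)
Lemma cost_upper :
  (forall k w, X k w \notin absorbing G ->
     ext_at (stage G V) k w <= (V (X k w))%:E) ->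
  expected_cost G C <= (V x)%:E.
Proof.
move=> HV; rewrite expected_cost_series.
have H k : \sum_(0 <= j < k) \int[P]_w stage_cost j w +
    \int[P]_(w in D k) (V (X k w))%:E <= (V x)%:E.
  elim: k => [|k IH].
    rewrite big_geq// add0e (_ : D 0 = setT); last by apply/seteqP; split.
    by rewrite integral_xi0.
  apply: le_trans IH; rewrite big_nat_recr//= -addeA leeD2l//.
  rewrite cost_to_go alive_split leeD2l//; apply: ge0_le_integral => //.
  - exact: measurable_alive.
  - by move=> w _; exact: stage_at_ge0.
  - by apply: measurable_funTS; exact: measurable_stage.
  - by apply: measurable_funTS; exact: measurable_at.
  - by move=> w Dw; apply: HV; exact: Dw.
apply: lime_le.
  by apply: is_cvg_nneseries => k _ _; apply: integral_ge0 => w _; exact: stage_cost_ge0.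
near=> k; apply: le_trans (H k); rewrite leeDl//.
by apply: integral_ge0 => w _; rewrite lee_fin.
Unshelve. all: by end_near. Qed.

Lemma potential_decay (h : S -> R) (beta : R) k :
  (forall y, (0 <= h y)%R) -> (0 <= beta)%R ->
  (forall y a b, K1 a -> K2 b -> (average G h y a b <= beta * h y)%R) ->
  \int[P]_(w in D k) (h (X k w))%:E <= (beta ^+ k * h x)%:E.
Proof.
move=> h0 beta0 hP; elim: k => [|k IH].
  rewrite (_ : D 0 = setT); last by apply/seteqP; split.
  by rewrite integral_xi0// expr0 mul1r.
rewrite (one_step h0 (@history_alive k)).
have ph y : payoff K1 K2 (average G h y) by exact: payoff_average.
apply: (@le_trans _ _ (\int[P]_(w in D k.+1) (beta * h (X k w))%:E)).
  apply: ge0_le_integral => //.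
  - exact: measurable_alive.
  - by move=> w _; exact: (ext_at_ge0 k w ph).
  - by apply: measurable_funTS; exact: (measurable_ext_at k ph).
  - by apply: measurable_funTS; exact: (measurable_at (fun y => beta * h y)%R).
  - move=> w _; have [P1 P2] := PU_at k w.
    rewrite -(@ext_cst R K1 K2 (measurable_U1 hG) (measurable_U2 hG)
      (beta * h (X k w)) (m1 C k w) (m2 C k w) P1 P2).
    apply: le_ext => //; last by move=> a b Ka Kb; exact: hP.
    apply: payoff_cst; first exact: (measurable_U1 hG).
      exact: (measurable_U2 hG).
    by rewrite mulr_ge0.
apply: (@le_trans _ _ (\int[P]_(w in D k) (beta * h (X k w))%:E)).
  apply: ge0_subset_integral.
  - exact: measurable_alive.
  - exact: measurable_alive.
  - by apply: measurable_funTS; exact: (measurable_at (fun y => beta * h y)%R).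
  - by move=> w _; rewrite lee_fin mulr_ge0.
  - by rewrite alive_beforeS; exact: subIsetl.
under eq_integral do rewrite EFinM.
rewrite ge0_integralZl//.
- by rewrite exprS -mulrA EFinM lee_wpmul2l// lee_fin.
- exact: measurable_alive.
- by apply: measurable_funTS; exact: measurable_at.
- by move=> w _; rewrite lee_fin.
Qed.

(** The remainder after [k] steps splits into terminal costs, which are part of the
total, and the expectation of [V] over the paths still alive, which is at most a
multiple of [beta ^+ k]. *)
Lemma cost_lower (h : S -> R) (beta : R) :
  (forall k w, X k w \notin absorbing G ->
     (V (X k w))%:E <= ext_at (stage G V) k w) ->
  (0 <= beta < 1)%R -> (forall y, (0 <= h y)%R) ->
  (forall y, y \notin absorbing G -> (1 <= h y)%R) ->
  (forall y a b, K1 a -> K2 b -> (average G h y a b <= beta * h y)%R) ->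
  (V x)%:E <= expected_cost G C.
Proof.
move=> HV /andP[beta0 beta1] h0 h1 hP; rewrite expected_cost_series.
have H k : (V x)%:E <= \sum_(0 <= j < k) \int[P]_w stage_cost j w +
    \int[P]_(w in D k) (V (X k w))%:E.
  elim: k => [|k IH].
    rewrite big_geq// add0e (_ : D 0 = setT); last by apply/seteqP; split.
    by rewrite integral_xi0.
  apply: le_trans IH _; rewrite big_nat_recr//= -addeA leeD2l//.
  rewrite cost_to_go alive_split leeD2l//; apply: ge0_le_integral => //.
  - exact: measurable_alive.
  - by move=> w _; rewrite lee_fin.
  - by apply: measurable_funTS; exact: measurable_at.
  - by apply: measurable_funTS; exact: measurable_stage.
  - by move=> w Dw; apply: HV; exact: Dw.
(* As [h >= 1] off the absorbing set, [V <= M * h] there. *)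
pose M := (\sum_y V y)%R.
have VM y : y \notin absorbing G -> (V y <= M * h y)%R.
  move=> yA; apply: (@le_trans _ _ M).
    by rewrite /M (bigD1 y)//= lerDl sumr_ge0.
  by rewrite ler_peMr ?h1// sumr_ge0.
have M0 : (0 <= M)%R by rewrite sumr_ge0.
have tail k : \int[P]_(w in D k.+1) (V (X k w))%:E <= (M * (beta ^+ k * h x))%:E.
  apply: (@le_trans _ _ (\int[P]_(w in D k.+1) (M * h (X k w))%:E)).
    apply: ge0_le_integral => //.
    - exact: measurable_alive.
    - by move=> w _; rewrite lee_fin.
    - by apply: measurable_funTS; exact: measurable_at.
    - by apply: measurable_funTS; exact: (measurable_at (fun y => M * h y)%R).
    - by move=> w Dw; rewrite lee_fin; apply: VM; exact: Dw.
  apply: (@le_trans _ _ (\int[P]_(w in D k) (M * h (X k w))%:E)).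
    apply: ge0_subset_integral.
    - exact: measurable_alive.
    - exact: measurable_alive.
    - by apply: measurable_funTS; exact: (measurable_at (fun y => M * h y)%R).
    - by move=> w _; rewrite lee_fin mulr_ge0.
    - by rewrite alive_beforeS; exact: subIsetl.
  under eq_integral do rewrite EFinM.
  rewrite ge0_integralZl//.
  - by rewrite EFinM lee_wpmul2l// ?lee_fin//; exact: potential_decay.
  - exact: measurable_alive.
  - by apply: measurable_funTS; exact: measurable_at.
  - by move=> w _; rewrite lee_fin.
apply/lee_addgt0Pr => e e0.
have [k ke] : exists k, (M * (beta ^+ k * h x) <= e)%R.
  have : ((M * h x) * (beta ^+ k))%R @[k --> \oo] --> (M * h x * 0)%R.
    by apply: cvgMr; apply: cvg_expr; rewrite ger0_norm.
  rewrite mulr0 => /cvgrPdist_le/(_ _ e0) /filter_ex[k].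
  rewrite sub0r normrN => hk; exists k; apply: le_trans hk.
  by rewrite [(beta ^+ k * h x)%R]mulrC mulrA; exact: ler_norm.
apply: le_trans (H k) _; rewrite alive_split addeA; apply: leeD; last first.
  by apply: le_trans (tail k) _; rewrite lee_fin.
apply: (@le_trans _ _ (\sum_(0 <= j < k.+1) \int[P]_w stage_cost j w)).
  rewrite big_nat_recr//= leeD2l// integral_stage_cost leeDr//.
  by apply: integral_ge0 => w _; exact: running_ge0.
apply: nneseries_lim_ge => j _ _.
by apply: integral_ge0 => w _; exact: stage_cost_ge0.
Qed.

End Verification.

End Chain.

(** * A random word with prescribed conditional laws *)

Section Words.
Variables (R : realType) (S : finType) (x : S) (q : seq S -> S -> R).
Hypothesis q0 : forall s y, 0 <= q s y.
Hypothesis q1 : forall s, \sum_y q s y = 1.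
Local Notation lam := (uniform_prob (@ltr01 R)).
Local Notation T := (measurableTypeR R).
Implicit Types (s : seq S) (w : R).

Definition cum s (i : nat) : R := \sum_(z <- take i (enum S)) q s z.

Fixpoint len s : R := if s is y :: s' then len s' * q s' y else 1.

(** Words list the most recent letter first.  The cell of [y :: s] is the
subinterval of the cell of [s] with relative length [q s y], the letters being
placed from left to right in the order of [enum S]; so the length of a cell is the
probability of its word. *)
Fixpoint lo s : R :=
  if s is y :: s' then lo s' + len s' * cum s' (index y (enum S)) else 0.

Definition cell s : set R := `[lo s, lo s + len s[%classic.

Lemma cumS s y : cum s (index y (enum S)).+1 = cum s (index y (enum S)) + q s y.
Proof.
have iy : (index y (enum S) < size (enum S))%N by rewrite index_mem mem_enum.
by rewrite /cum (take_nth y)// big_rcons/= nth_index ?mem_enum.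
Qed.

Lemma cum_nondecreasing s i j : (i <= j)%N -> cum s i <= cum s j.
Proof.
move=> ij; rewrite /cum -(subnKC ij) takeD big_cat/= lerDl.
exact: sumr_ge0.
Qed.

Lemma cum_size s : cum s (size (enum S)) = 1.
Proof. by rewrite /cum take_size -(q1 s) big_enum. Qed.

Lemma cum_le1 s i : cum s i <= 1.
Proof.
have [h|/ltnW h] := leqP i (size (enum S)).
  by rewrite -(cum_size s); exact: cum_nondecreasing.
by rewrite /cum take_oversize// -(cum_size s) /cum take_size.
Qed.

Lemma cum_ge0 s i : 0 <= cum s i. Proof. exact: sumr_ge0. Qed.

Lemma len_ge0 s : 0 <= len s.
Proof. by elim: s => [|y s IH] /=; [exact: ler01|exact: mulr_ge0]. Qed.

Lemma cell_cons y s : cell (y :: s) =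
  `[lo s + len s * cum s (index y (enum S)),
    lo s + len s * cum s (index y (enum S)).+1[%classic.
Proof. by rewrite /cell/= cumS mulrDr addrA. Qed.

Lemma cell_sub y s : cell (y :: s) `<=` cell s.
Proof.
rewrite cell_cons => w; rewrite /cell/= !in_itv/= => /andP[w1 w2].
rewrite (le_trans _ w1) ?lerDl ?mulr_ge0 ?len_ge0 ?cum_ge0//=.
by rewrite (lt_le_trans w2)// lerD2l ler_piMr ?len_ge0 ?cum_le1.
Qed.

Lemma cell01 s : cell s `<=` `[0, 1[%classic.
Proof.
elim: s => [|y s IH]; first by rewrite /cell/= add0r.
exact: subset_trans (@cell_sub y s) IH.
Qed.

Lemma cell_child s w : cell s w -> exists y, cell (y :: s) w.
Proof.
rewrite {1}/cell/= in_itv/= => /andP[w1 w2].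
have len0 : 0 < len s by have := le_lt_trans w1 w2; rewrite ltrDl.
have ex : exists i, w < lo s + len s * cum s i.+1.
  exists (size (enum S)).-1.
  have S0 : (0 < size (enum S))%N.
    by rewrite -cardE; apply/card_gt0P; exists x.
  by rewrite prednK// cum_size mulr1.
(* [i] is the rank of the first letter whose cell ends beyond [w]. *)
case: (ex_minnP ex) => i wi imin.
have iS : (i < size (enum S))%N.
  rewrite ltnNge; apply/negP => Si.
  case: i Si wi imin => [|i] Si wi imin.
    move: wi; rewrite /cum take_oversize ?(leq_trans Si)//.
    move: Si; rewrite leqn0 => /nilP ->; rewrite big_nil mulr0 addr0.
    by rewrite ltNge w1.
  have : (i.+1 <= i)%N.
    apply: imin; move: wi; rewrite /cum !take_oversize//.
    exact: leq_trans Si _.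
  by rewrite ltnn.
exists (nth x (enum S) i); rewrite cell_cons/= in_itv/=.
rewrite index_uniq ?enum_uniq// wi andbT.
case: i wi imin iS => [|i] wi imin iS.
  by rewrite /cum take0 big_nil mulr0 addr0.
rewrite leNgt; apply/negP => h; have := imin i h.
by rewrite ltnn.
Qed.

Lemma cell_unique s y z w : cell (y :: s) w -> cell (z :: s) w -> y = z.
Proof.
rewrite !cell_cons/= !in_itv/= => /andP[y1 y2] /andP[z1 z2].
have idx a b : lo s + len s * cum s (index a (enum S)) <= w ->
    w < lo s + len s * cum s (index b (enum S)).+1 ->
    (index a (enum S) <= index b (enum S))%N.
  move=> aw wb; rewrite leqNgt; apply/negP => ba.
  have := le_lt_trans aw wb; apply/negP; rewrite -leNgt lerD2l.
  by rewrite ler_wpM2l ?len_ge0// cum_nondecreasing.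
have /eqP : index y (enum S) = index z (enum S).
  by apply/eqP; rewrite eqn_leq !idx.
move=> /eqP h; rewrite -(nth_index x (mem_enum S y)) h.
by rewrite nth_index ?mem_enum.
Qed.

(** Outside the unit interval, a null set, no cell contains [w] and the letter is
[x]. *)
Definition next s w : S := xget x [set y | cell (y :: s) w].

Lemma nextP s w : (exists y, cell (y :: s) w) -> cell (next s w :: s) w.
Proof. by move=> ex; exact: (@xgetPex S x [set y | cell (y :: s) w] ex). Qed.

Fixpoint word k w : seq S :=
  if k is k'.+1 then next (word k' w) w :: word k' w else [::].

Lemma size_word k w : size (word k w) = k.
Proof. by elim: k => //= k ->. Qed.

Lemma word_cell k w : `[0, 1[%classic w -> cell (word k w) w.
Proof.
move=> w01; elim: k => [|k IH] /=; first by rewrite /cell/= add0r.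
exact: nextP (cell_child IH).
Qed.

Lemma cell_word s w : cell s w -> word (size s) w = s.
Proof.
elim: s => //= y s IH ysw; rewrite (IH (cell_sub ysw)); congr (_ :: _).
by apply: (cell_unique (nextP _) ysw); exists y.
Qed.

Lemma word_out k w : ~ `[0, 1[%classic w -> word k w = nseq k x.
Proof.
move=> w01; elim: k => //= k ->; congr (_ :: _).
by rewrite /next xgetPN// => y /cell01.
Qed.

Definition event s : set R := [set w | word (size s) w = s].

Lemma eventE s : event s = cell s `|`
  (if s == nseq (size s) x then ~` `[0, 1[%classic else set0).
Proof.
apply/seteqP; split => w; rewrite /event/=.
  move=> ws; have [w01|w01] := pselect (`[0, 1[%classic w).
    by left; rewrite -ws; exact: word_cell.
  by right; move: ws; rewrite word_out// => ws; rewrite ws eqxx.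
case=> [/cell_word//|]; case: eqP => // sx w01.
by rewrite word_out.
Qed.

Lemma measurable_event s : measurable (event s : set T).
Proof.
rewrite eventE; apply: measurableU; first exact: measurable_itv.
by case: ifP => _; [apply: measurableC; exact: measurable_itv|].
Qed.

Lemma lo_ge0 s : 0 <= lo s.
Proof.
by elim: s => //= y s IH; rewrite addr_ge0// mulr_ge0 ?len_ge0 ?cum_ge0.
Qed.

Lemma hi_le1 s : lo s + len s <= 1.
Proof.
elim: s => [|y s IH] /=; first by rewrite add0r.
apply: le_trans IH; rewrite -addrA lerD2l -mulrDr -cumS.
by rewrite ler_piMr ?len_ge0// cum_le1.
Qed.

Lemma event_prob s : lam (event s) = (len s)%:E.
Proof.
have lc : lam (cell s) = (len s)%:E.
  rewrite /cell uniform_itv ?lo_ge0 ?hi_le1//; last by rewrite lerDl len_ge0.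
  by rewrite addrAC subrr add0r.
have mc : measurable (cell s : set T) by exact: measurable_itv.
rewrite eventE; case: ifP => _; last by rewrite setU0.
have lout : lam (~` `[0, 1[%classic) = 0%E := uniform_setC_itv R.
have mo : measurable (~` `[0, 1[%classic : set T).
  by apply: measurableC; exact: measurable_itv.
rewrite -lc; apply/eqP; rewrite eq_le; apply/andP; split.
  apply: le_trans (measureU2 _ mc mo) _.
  by rewrite [X in (_ + X)%E]lout adde0.
by apply: le_measure; rewrite ?inE//; exact: measurableU.
Qed.

Lemma word_preimage n (B : set (seq S)) : word n @^-1` B =
  \bigcup_(t : n.-tuple S) (if `[< B t >] then event t else set0).
Proof.
apply/seteqP; split => w /=.
  move=> Bw; exists (Tuple (introT eqP (size_word n w))) => //=.
  by rewrite asboolT//= /event/= size_word.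
by case=> t _; case: asboolP => // Bt; rewrite /event/= size_tuple => ->.
Qed.

Lemma measurable_word n (B : set (seq S)) : measurable (word n @^-1` B : set T).
Proof.
rewrite word_preimage; apply: countable_bigcupT_measurable; first exact: countableP.
by move=> t; case: ifP => _; [exact: measurable_event|exact: measurable0].
Qed.

Lemma integral_word n (f : seq S -> R) (B : set (seq S)) : (forall s, 0 <= f s) ->
  (\int[lam]_(w in word n @^-1` B) (f (word n w))%:E =
   \sum_(t : n.-tuple S) (if `[< B t >] then (f t * len t)%:E else 0%E))%E.
Proof.
move=> f0; rewrite integral_mkcond.
rewrite (eq_integral (fun w : T => \sum_(t : n.-tuple S)
   (if `[< B t >] then f t else 0)%:E * (\1_(event t) w)%:E)%E); last first.
  move=> w _.
  have sw : size (word n w) == n by rewrite size_word.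
  rewrite (bigD1 (Tuple sw))//= big1 ?adde0.
    rewrite indicE mem_set ?mule1; last by rewrite /event/= size_word.
    rewrite patchE; case: ifPn => [/set_mem/= Bw|/negP nB]; first by rewrite asboolT.
    by rewrite asboolF// => Bw; apply: nB; rewrite inE.
  move=> t tw; rewrite indicE memNset ?mule0// /event/= size_tuple => wt.
  by move: tw; rewrite -val_eqE/= wt eqxx.
rewrite ge0_integral_sum//.
- apply: eq_bigr => t _; rewrite ge0_integralZl//.
  + rewrite integral_indic// ?setIT; last exact: measurable_event.
    rewrite [X in (_ * X)%E]event_prob; case: ifP => _; last by rewrite mul0e.
    by rewrite EFinM.
  + by apply/measurable_EFinP; apply: measurable_indic; exact: measurable_event.
  + by rewrite lee_fin; case: ifP.
- move=> t; apply: measurable_funeM; apply/measurable_EFinP.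
  by apply: measurable_indic; exact: measurable_event.
- by move=> t w _; rewrite mule_ge0// lee_fin//; case: ifP.
Qed.

(** The conditional law of the next letter given the word is [q]. *)
Lemma prob_next n y (B : set (seq S)) :
  (lam (word n @^-1` B `&` [set w | next (word n w) w = y]) =
   \int[lam]_(w in word n @^-1` B) (q (word n w) y)%:E)%E.
Proof.
rewrite (integral_word n B (fun s => q0 s y)).
have mA : measurable (word n @^-1` B `&` [set w | next (word n w) w = y] : set T).
  have -> : word n @^-1` B `&` [set w | next (word n w) w = y] =
      word n.+1 @^-1` [set s | B (behead s) /\ head x s = y].
    by apply/seteqP; split => w [].
  exact: measurable_word.
rewrite -[X in lam X]setIT -integral_indic//.
rewrite (eq_integral (fun w : T => \sum_(t : n.-tuple S)
   (if `[< B t >] then 1 else 0)%:E * (\1_(event (y :: t)) w)%:E)%E); last first.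
  move=> w _.
  have sw : size (word n w) == n by rewrite size_word.
  rewrite (bigD1 (Tuple sw))//= big1 ?adde0.
    rewrite !indicE; case: asboolP => Bw.
      rewrite mul1e; congr (_%:R%:E); congr (nat_of_bool _).
      apply/idP/idP => /set_mem; rewrite /event/= size_word.
        by move=> [_ nw]; apply/mem_set => /=; rewrite nw.
      by case=> nw; apply/mem_set.
    by rewrite mul0e memNset// => -[].
  move=> t tw; rewrite [X in (_ * X%:E)%E]indicE memNset ?mule0//.
  rewrite /event/= size_tuple => -[_ wt].
  by move: tw; rewrite -val_eqE/= wt eqxx.
rewrite ge0_integral_sum//.
- apply: eq_bigr => t _; rewrite ge0_integralZl//.
  + rewrite integral_indic// ?setIT; last exact: measurable_event.
    rewrite [X in (_ * X)%E]event_prob; case: ifP => _; last by rewrite mul0e.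
    by rewrite mul1e/= mulrC.
  + by apply/measurable_EFinP; apply: measurable_indic; exact: measurable_event.
  + by rewrite lee_fin; case: ifP.
- move=> t; apply: measurable_funeM; apply/measurable_EFinP.
  by apply: measurable_indic; exact: measurable_event.
- by move=> t w _; rewrite mule_ge0// lee_fin//; case: ifP.
Qed.

End Words.

(** * Existence of controlled chains *)

Section Construction.
Variables (R : realType) (S : finType) (G : game R S).
Hypothesis hG : is_game G.
Hypothesis hp : forall x y : S,
  {within U1 G `*` U2 G, continuous (fun r : R * R => p G x y r.1 r.2)}.
Variables (x : S) (a1 a2 : seq S -> relaxed R).
Hypothesis PUa1 : forall s, PU (U1 G) (a1 s).
Hypothesis PUa2 : forall s, PU (U2 G) (a2 s).
Local Notation K1 := (U1 G).
Local Notation K2 := (U2 G).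
Local Notation T := (measurableTypeR R).
Local Notation lam := (uniform_prob (@ltr01 R)).

(** Under [q [::]] the first letter is [x], so that the chain starts at [x]. *)
Definition next_law (s : seq S) (y : S) : R :=
  if s is z :: _ then fine (ext K1 K2 (p G z y) (a1 s) (a2 s)) else (y == x)%:R.

Lemma next_law_ge0 s y : 0 <= next_law s y.
Proof.
case: s => [|z s]; first by rewrite /= ler0n.
by apply: fine_ge0; apply: ext_ge0; exact: payoff_p.
Qed.

Lemma ext_p_sum1 z mu nu : PU K1 mu -> PU K2 nu ->
  (\sum_y ext K1 K2 (p G z y) mu nu = 1)%E.
Proof.
move=> P1 P2; rewrite -(@ext_cst R K1 K2 (measurable_U1 hG) (measurable_U2 hG) 1 mu nu P1 P2).
rewrite -(ext_sum (measurable_U1 hG) (measurable_U2 hG))//; last first.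
  by move=> y; exact: payoff_p.
by apply: eq_ext => a b Ka Kb; rewrite (p_sum1 hG).
Qed.

Lemma next_lawE z s y :
  ext K1 K2 (p G z y) (a1 (z :: s)) (a2 (z :: s)) = (next_law (z :: s) y)%:E.
Proof.
rewrite /= fineK//; have := ext_p_sum1 z (PUa1 (z :: s)) (PUa2 (z :: s)).
have e0 y' : (0 <= ext K1 K2 (p G z y') (a1 (z :: s)) (a2 (z :: s)))%E.
  by apply: ext_ge0; exact: payoff_p.
rewrite (bigD1 y)//= => h; rewrite ge0_fin_numE//.
apply: (@le_lt_trans _ _ 1%E); last exact: ltry.
by rewrite -h leeDl// sume_ge0.
Qed.

Lemma next_law_sum1 s : \sum_y next_law s y = 1.
Proof.
case: s => [|z s].
  rewrite /= (bigD1 x)//= eqxx big1 ?addr0// => y /negbTE.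
  by move=> ->.
apply: EFin_inj; rewrite -sumEFin.
under eq_bigr do rewrite -next_lawE.
exact: ext_p_sum1.
Qed.

Local Notation word := (@word R S x next_law).

Definition chain : controlled_chain R S :=
  @ControlledChain R S _ T lam (fun k w => next x next_law (word k w) w)
    (fun k w => a1 (word k.+1 w)) (fun k w => a2 (word k.+1 w)).

Lemma word_drop k n w : (k <= n)%N -> word k w = drop (n - k) (word n w).
Proof.
elim: n => [|n IH]; first by rewrite leqn0 => /eqP ->.
rewrite leq_eqVlt => /predU1P[->|kn]; first by rewrite subnn drop0.
by rewrite subSn//= IH.
Qed.

(** The states and controls up to time [n] are functions of the word of length
[n + 1]. *)
Lemma history_word n A : history chain n A -> exists B, A = word n.+1 @^-1` B.
Proof.
move: A; apply: smallest_sub.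
  split.
  - by exists set0; rewrite preimage_set0.
  - by move=> A [B ->]; exists (~` B); rewrite setTD preimage_setC.
  - move=> F HF; have [B BP] := choice HF.
    by exists (\bigcup_k B k); rewrite preimage_bigcup; apply: eq_bigcupr.
move=> A [k /= kn gA].
have H (U : Type) (f : seq S -> U) (Q : set U) :
    exists B, (f \o word k.+1) @^-1` Q = word n.+1 @^-1` B.
  exists [set s | Q (f (drop (n.+1 - k.+1) s))].
  apply/funext => w; rewrite -[LHS]/(Q (f (word k.+1 w))).
  by rewrite (@word_drop k.+1 n.+1).
case: gA => [[[y _ <-]|[Q mQ <-]]|[Q mQ <-]].
- exact: (H _ (head x) [set y]).
- by rewrite setTI; exact: (H _ a1 Q).
- by rewrite setTI; exact: (H _ a2 Q).
Qed.

Lemma chain_admissible : admissible G x chain.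
Proof.
have mw n B : measurable (word n @^-1` B : set T).
  by apply: measurable_word; [exact: next_law_ge0|exact: next_law_sum1].
split.
- move=> k y; exact: (mw k.+1 [set s | head x s = y]).
- by move=> k; split => _ B mB; rewrite setTI;
    [exact: (mw k.+1 [set s | B (a1 s)])|exact: (mw k.+1 [set s | B (a2 s)])].
- by move=> k w; split; [exact: PUa1|exact: PUa2].
- have := event_prob x next_law_ge0 next_law_sum1 [:: x].
  rewrite /= mul1r eqxx => h; rewrite -[RHS]h; congr (lam _).
  apply/seteqP; split => w; rewrite /event/=; first by move=> ->.
  by case.
- move=> n y A /history_word[B ->].
  apply: etrans (prob_next x next_law_ge0 next_law_sum1 n.+1 y B) _.
  apply: eq_integral => w _; exact/esym/next_lawE.
Qed.

Lemma word_xi k w : word k w = rev (mkseq (fun i => xi chain i w) k).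
Proof. by elim: k => [|k IH]//=; rewrite mkseqS rev_rcons -IH. Qed.

End Construction.

Lemma chain_exists (R : realType) (S : finType) (G : game R S) :
  is_game G -> (forall x y : S,
  {within U1 G `*` U2 G, continuous (fun r : R * R => p G x y r.1 r.2)}) ->
  forall (x : S) (a1 a2 : seq S -> relaxed R),
  (forall s, PU (U1 G) (a1 s)) -> (forall s, PU (U2 G) (a2 s)) ->
  exists C : controlled_chain R S, [/\ admissible G x C,
    forall k w, m1 C k w = a1 (rev (mkseq (fun i => xi C i w) k.+1)) &
    forall k w, m2 C k w = a2 (rev (mkseq (fun i => xi C i w) k.+1))].
Proof.
move=> hG hp x a1 a2 P1 P2; exists (chain G x a1 a2); split.
- exact: chain_admissible.
- by move=> k w; rewrite -word_xi.
- by move=> k w; rewrite -word_xi.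
Qed.

(** * Optimal stationary rules *)

Section Assembly.
Variables (R : realType) (S : finType) (G : game R S).
Hypothesis hG : is_game G.
Hypothesis hp : forall x y : S,
  {within U1 G `*` U2 G, continuous (fun r : R * R => p G x y r.1 r.2)}.
Hypothesis hc : forall x : S,
  {within U1 G `*` U2 G, continuous (fun r : R * R => c G x r.1 r.2)}.
Local Notation K1 := (U1 G).
Local Notation K2 := (U2 G).
Local Notation T := (measurableTypeR R).
Implicit Types (V : S -> R) (x y : S).

(** A rule of the first player may use that player's own past controls; these are
recomputed from the past states by recursion on the word, starting from an
arbitrary default control [d0] that no rule ever sees. *)
Lemma rule_chain_exists x
    (rule : nat -> (nat -> S) -> (nat -> relaxed R) -> relaxed R)
    (b : nat -> S -> relaxed R) :
  (forall n z z' o o', (forall i, (i <= n)%N -> z i = z' i) ->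
     (forall i, (i < n)%N -> o i = o' i) -> rule n z o = rule n z' o') ->
  (forall n z o, PU K1 (rule n z o)) -> (forall n y, PU K2 (b n y)) ->
  exists C : controlled_chain R S, [/\ admissible G x C,
    forall k w, m1 C k w = rule k (fun i => xi C i w) (fun i => m1 C i w) &
    forall k w, m2 C k w = b k (xi C k w)].
Proof.
move=> loc P1 P2; have [r0 Kr0] := U1_neq0 hG.
pose d0 : relaxed R := @dirac _ T r0 R : relaxed R.
(* The past controls of the first player, the most recent one first. *)
pose fix owns (s : seq S) : seq (relaxed R) := if s is y :: s' then
  rule (size s') (nth x (rev s)) (nth d0 (rev (owns s'))) :: owns s' else [::].
pose a1 s := head d0 (owns s).
pose a2 s := b (size s).-1 (head x s).
have Pa1 s : PU K1 (a1 s).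
  by case: s => [|y s]; [exact: PU_dirac|exact: P1].
have [C [admC C1 C2]] := chain_exists hG hp x Pa1 (fun s => P2 (size s).-1 (head x s)).
exists C; split => // k w; last first.
  by rewrite C2 /= mkseqS rev_rcons/= size_rev size_mkseq.
pose z i := xi C i w; pose o i := m1 C i w.
have ownsE n : owns (rev (mkseq z n)) = rev (mkseq o n).
  elim: n => [//|n IH].
  rewrite (mkseqS o) rev_rcons -IH (mkseqS z) rev_rcons /=; congr (_ :: _).
  by rewrite /o C1 /a1 (mkseqS z) rev_rcons.
rewrite C1 -/z /a1 mkseqS rev_rcons/= size_rev size_mkseq.
apply: loc => i ik.
  by rewrite -rev_rcons revK -mkseqS nth_mkseq.
by rewrite ownsE revK nth_mkseq.
Qed.

Lemma follows_first_exists x (H : first_rule R S) (b : S -> relaxed R) :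
  Gamma_first K1 H -> (forall y, PU K2 (b y)) ->
  exists C : controlled_chain R S, [/\ admissible G x C,
    follows_first H (xi C) (m1 C) (m2 C) & forall k w, m2 C k w = b (xi C k w)].
Proof.
move=> HG Pb.
pose rule n (z : nat -> S) (o : nat -> relaxed R) :=
  H n [tuple z k | k < n.+1] [tuple o k | k < n] [tuple b (z k) | k < n].
have [||//|C [admC C1 C2]] := @rule_chain_exists x rule (fun=> b).
- move=> n z z' o o' zz' oo'; rewrite /rule; congr (H n _ _ _);
    apply: eq_from_tnth => i; rewrite !tnth_mktuple ?zz' ?oo'//.
    by rewrite -ltnS.
  exact: ltnW.
- by move=> n z o; have [_] := HG n [tuple z k | k < n.+1]; exact.
exists C; split => // n w; rewrite C1 /rule; congr (H n _ _ _).
by apply: eq_from_tnth => i; rewrite !tnth_mktuple C2.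
Qed.

Lemma follows_last_exists x (H : last_rule R S) (b : S -> relaxed R) :
  Gamma_last K1 H -> (forall y, PU K2 (b y)) ->
  exists C : controlled_chain R S, [/\ admissible G x C,
    follows_last H (xi C) (m1 C) (m2 C) & forall k w, m2 C k w = b (xi C k w)].
Proof.
move=> HG Pb.
pose rule n (z : nat -> S) (o : nat -> relaxed R) :=
  H n [tuple z k | k < n.+1] [tuple o k | k < n] [tuple b (z k) | k < n.+1].
have [||//|C [admC C1 C2]] := @rule_chain_exists x rule (fun=> b).
- move=> n z z' o o' zz' oo'; rewrite /rule; congr (H n _ _ _);
    apply: eq_from_tnth => i; rewrite !tnth_mktuple ?zz' ?oo'//.
    by rewrite -ltnS.
  by rewrite -ltnS.
- by move=> n z o; have [_] := HG n [tuple z k | k < n.+1]; exact.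
exists C; split => // n w; rewrite C1 /rule; congr (H n _ _ _).
by apply: eq_from_tnth => i; rewrite !tnth_mktuple C2.
Qed.

(** Playing the pure actions of [exit_bound] gives an admissible chain along which
the expectation of [u (n - k)] at time [k] is constant in [k]. *)
Lemma exit_bound_of_chains (n : nat) (gamma : R) :
  (forall (x : S) (C : controlled_chain R S), admissible G x C ->
     (gamma%:E <= Pr C [set w | xi C n w \in absorbing G])%E) ->
  exit_bound G n gamma.
Proof.
move=> hexit r u Kr u0E uS x.
have u0 k y : 0 <= u k y.
  elim: k y => [|k IH] y; first by rewrite u0E /alive ler0n.
  by have [? ?] := Kr k y; rewrite uS; exact: (average_ge0 hG).
(* At time [k] there are [(m k).+1] steps to go. *)
pose m k := (n.-1 - k)%N.
pose rule k (z : nat -> S) (o : nat -> relaxed R) : relaxed R :=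
  @dirac _ T (r (m k) (z k)).1 R.
pose b k y : relaxed R := @dirac _ T (r (m k) y).2 R.
have [|||C [admC C1 C2]] := @rule_chain_exists x rule b.
- by move=> k z z' o o' zz' _; rewrite /rule zz'.
- by move=> k z o; apply: PU_dirac; have [] := Kr (m k) (z k).
- by move=> k y; apply: PU_dirac; have [] := Kr (m k) y.
have H k : (k <= n)%N ->
    (\int[Pr C]_w (u (n - k)%N (xi C k w))%:E = (u n x)%:E)%E.
  elim: k => [_|k IH kn]; first by rewrite subn0 (integral_xi0 admC).
  rewrite (one_step hG hp admC _ (@history_setT R S C k))// -(IH (ltnW kn)).
  apply: eq_integral => w _; rewrite /ext_at C1 C2 /rule /b.
  have [Ka Kb] := Kr (m k) (xi C k w).
  rewrite ext_dirac//; last exact: payoff_average.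
  have -> : (n - k)%N = (m k).+1 by rewrite /m -subn1 -subnDA add1n subnSK.
  by rewrite uS; congr (average G (u _) _ _ _)%:E; rewrite /m -subn1 -subnDA add1n.
have mA : measurable [set w | xi C n w \in absorbing G].
  exact: (history_measurable admC (@history_xi _ _ C n n [set y | y \in absorbing G] (leqnn n))).
have := H n (leqnn n); rewrite subnn u0E.
rewrite (eq_integral (fun w => (\1_(~` [set w | xi C n w \in absorbing G]) w)%:E)); last first.
  move=> w _; rewrite /alive indicE; congr (_%:R%:E); congr (nat_of_bool _).
  apply/idP/idP => h; first by apply/mem_set/negP.
  by apply/negP; exact: set_mem h.
rewrite integral_indic ?setIT//; last exact: measurableC.
move=> h; rewrite -lee_fin -h [X in (X <= _)%E](probability_setC (Pr C) mA) EFinB.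
by rewrite leeB// (hexit x).
Qed.

Lemma ext_at_stage_le V (mu1 : S -> relaxed R) x (C : controlled_chain R S) :
  admissible G x C ->
  (forall y, y \notin absorbing G -> forall nu, PU K2 nu ->
     (ext K1 K2 (stage G V y) (mu1 y) nu <= (V y)%:E)%E) ->
  (forall k w, m1 C k w = mu1 (xi C k w)) ->
  forall k w, xi C k w \notin absorbing G ->
    (ext_at G (stage G V) k w <= (V (xi C k w))%:E)%E.
Proof.
move=> admC opt C1 k w nA; rewrite /ext_at C1; apply: opt => //.
by case: admC => _ _ /(_ k w)[].
Qed.

Lemma ext_at_stage_ge V (mu2 : S -> relaxed R) x (C : controlled_chain R S) :
  admissible G x C ->
  (forall y, y \notin absorbing G -> forall mu, PU K1 mu ->
     ((V y)%:E <= ext K1 K2 (stage G V y) mu (mu2 y))%E) ->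
  (forall k w, m2 C k w = mu2 (xi C k w)) ->
  forall k w, xi C k w \notin absorbing G ->
    ((V (xi C k w))%:E <= ext_at G (stage G V) k w)%E.
Proof.
move=> admC opt C2 k w nA; rewrite /ext_at C2; apply: opt => //.
by case: admC => _ _ /(_ k w)[].
Qed.

End Assembly.

Theorem mainTheorem2 (R : realType) (S : finType) (G : game R S)
  (hG : is_game G)
  (n : nat) (hn : (1 <= n)%N) (gamma : R) (hgamma : 0 < gamma)
  (hexit : forall (x : S) (C : controlled_chain R S), admissible G x C ->
     (gamma%:E <= Pr C [set w | xi C n w \in absorbing G])%E)
  (hp : forall x y : S,
     {within U1 G `*` U2 G, continuous (fun r : R * R => p G x y r.1 r.2)})
  (hc : forall x : S,
     {within U1 G `*` U2 G, continuous (fun r : R * R => c G x r.1 r.2)}) :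
  forall x : S,
    [/\ V_upper G x = V_lower G x, V_upper_attained G x & V_lower_attained G x].
Proof.
have hM := exit_bound_of_chains hG hp hexit.
have [h [beta [beta01 h0 hh hbeta]]] := exit_potential hG hp hgamma hM.
have h1 y : y \notin absorbing G -> 1 <= h y.
  move=> yA; have [a Ka] := U1_neq0 hG; have [b Kb] := U2_neq0 hG.
  apply: le_trans (hh y a b Ka Kb); rewrite /alive yA lerDl.
  exact: (average_ge0 hG).
have [V V0 VE] := shapley_fixpoint hG hp hc h0 hh.
have Vg y : y \in absorbing G -> V y = g G y by move=> yA; rewrite VE /shapley yA.
have optE y : exists m : relaxed R * relaxed R, [/\ PU (U1 G) m.1, PU (U2 G) m.2 &
    y \notin absorbing G -> is_value (U1 G) (U2 G) (stage G V y) (V y) m.1 m.2].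
  have [_ [mu1 [mu2 val]]] := stage_valueP hG hp hc y V0.
  have [P1 P2 _ _] := val.
  exists (mu1, mu2); split => // yA.
  by rewrite VE /shapley (negbTE yA).
have [mu muP] := choice optE.
pose mu1 y := (mu y).1; pose mu2 y := (mu y).2.
have P1 y : PU (U1 G) (mu1 y) by have [] := muP y.
have P2 y : PU (U2 G) (mu2 y) by have [] := muP y.
have opt1 y : y \notin absorbing G -> forall nu, PU (U2 G) nu ->
    (ext (U1 G) (U2 G) (stage G V y) (mu1 y) nu <= (V y)%:E)%E.
  by move=> yA; have [_ _ /(_ yA)[]] := muP y.
have opt2 y : y \notin absorbing G -> forall nu, PU (U1 G) nu ->
    ((V y)%:E <= ext (U1 G) (U2 G) (stage G V y) nu (mu2 y))%E.
  by move=> yA; have [_ _ /(_ yA)[]] := muP y.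
have upper z (C : controlled_chain R S) : admissible G z C ->
    (forall k w, m1 C k w = mu1 (xi C k w)) -> (expected_cost G C <= (V z)%:E)%E.
  by move=> admC C1; apply: (cost_upper hG hp hc admC V0 Vg);
    exact: (ext_at_stage_le admC opt1 C1).
have lower z (C : controlled_chain R S) : admissible G z C ->
    (forall k w, m2 C k w = mu2 (xi C k w)) -> ((V z)%:E <= expected_cost G C)%E.
  by move=> admC C2; apply: (cost_lower hG hp hc admC V0 Vg
    (ext_at_stage_ge admC opt2 C2) beta01 h0 h1 hbeta).
move=> x.
pose F1 : first_rule R S := fun n s _ _ => mu1 (tnth s ord_max).
pose L1 : last_rule R S := fun n s _ _ => mu1 (tnth s ord_max).
pose F2 : first_rule R S := fun n s _ _ => mu2 (tnth s ord_max).
pose L2 : last_rule R S := fun n s _ _ => mu2 (tnth s ord_max).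
have GF1 : Gamma_first (U1 G) F1.
  by move=> k s; split => [|? ?]; [exact: measurable_cst|exact: P1].
have GL1 : Gamma_last (U1 G) L1.
  by move=> k s; split => [|? ?]; [exact: measurable_cst|exact: P1].
have GF2 : Gamma_first (U2 G) F2.
  by move=> k s; split => [|? ?]; [exact: measurable_cst|exact: P2].
have GL2 : Gamma_last (U2 G) L2.
  by move=> k s; split => [|? ?]; [exact: measurable_cst|exact: P2].
have W12_le H2 : (W_12 G x F1 H2 <= (V x)%:E)%E.
  rewrite /W_12; case: xgetP => [v -> [C [admC C1 _ ->]]|_]; last by rewrite lee_fin.
  by apply: upper => // k w; rewrite C1 /F1 tnth_mktuple.
have W12_ge H1 : Gamma_first (U1 G) H1 -> ((V x)%:E <= W_12 G x H1 L2)%E.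
  move=> GH1; have [C0 [adm0 C01 C02]] := follows_first_exists hG hp x GH1 P2.
  rewrite /W_12; case: xgetP => [v -> [C [admC _ C2 ->]]|none].
    by apply: lower => // k w; rewrite C2 /L2 tnth_mktuple.
  exfalso; apply: (none (expected_cost G C0)); exists C0; split => //.
  by move=> k w; rewrite C02 /L2 tnth_mktuple.
have W21_le H2 : (W_21 G x L1 H2 <= (V x)%:E)%E.
  rewrite /W_21; case: xgetP => [v -> [C [admC C1 _ ->]]|_]; last by rewrite lee_fin.
  by apply: upper => // k w; rewrite C1 /L1 tnth_mktuple.
have W21_ge H1 : Gamma_last (U1 G) H1 -> ((V x)%:E <= W_21 G x H1 F2)%E.
  move=> GH1; have [C0 [adm0 C01 C02]] := follows_last_exists hG hp x GH1 P2.
  rewrite /W_21; case: xgetP => [v -> [C [admC _ C2 ->]]|none].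
    by apply: lower => // k w; rewrite C2 /F2 tnth_mktuple.
  exfalso; apply: (none (expected_cost G C0)); exists C0; split => //.
  by move=> k w; rewrite C02 /F2 tnth_mktuple.
have W12E : W_12 G x F1 L2 = (V x)%:E.
  by apply/eqP; rewrite eq_le W12_le W12_ge.
have W21E : W_21 G x L1 F2 = (V x)%:E.
  by apply/eqP; rewrite eq_le W21_le W21_ge.
have wuE : worst_upper G x F1 = (V x)%:E.
  apply/eqP; rewrite eq_le; apply/andP; split.
    by apply: ge_ereal_sup => _ [H2 _ <-].
  by rewrite -W12E; apply: ereal_sup_ubound; exists L2.
have wlE : worst_lower G x F2 = (V x)%:E.
  apply/eqP; rewrite eq_le; apply/andP; split.
    by rewrite -W21E; apply: ereal_inf_lbound; exists L1.
  by apply: le_ereal_inf_tmp => _ [H1 GH1 <-]; exact: W21_ge.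
have VuE : V_upper G x = (V x)%:E.
  apply/eqP; rewrite eq_le; apply/andP; split.
    by rewrite -wuE; apply: ereal_inf_lbound; exists F1.
  apply: le_ereal_inf_tmp => _ [H1 GH1 <-]; apply: le_trans (W12_ge H1 GH1) _.
  by apply: ereal_sup_ubound; exists L2.
have VlE : V_lower G x = (V x)%:E.
  apply/eqP; rewrite eq_le; apply/andP; split.
    apply: ge_ereal_sup => _ [H2 GH2 <-]; apply: le_trans (W21_le H2).
    by apply: ereal_inf_lbound; exists L1.
  by rewrite -wlE; apply: ereal_sup_ubound; exists F2.
split; first by rewrite VuE VlE.
- by exists F1, L2; split => //; rewrite ?wuE ?W12E VuE.
- by exists L1, F2; split => //; rewrite ?wlE ?W21E VlE.
Qed.
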